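(* Let $t$ be a positive integer and let $\lambda=(\lambda_1,\lambda_2,\dots,\lambda_r)$ be a partition with $\lambda_1=\lambda_2$ (so $r\ge2$). If $\lambda_1>t$, then $$\Delta_t^\lambda\simeq \Delta_t^{\lambda'}\vee\Sigma\left(\Delta_t^{\lambda''}\right)\vee\Sigma^2\left(\Delta_t^{\lambda'''}\right),$$ where - $\lambda'=(\lambda_2,\lambda_3,\dots,\lambda_r)$, - $\lambda''=(\min\{\lambda_1-1,\lambda_2\},\min\{\lambda_1-1,\lambda_3\},\dots,\min\{\lambda_1-1,\lambda_r\})$, - $\lambda'''=(\min\{\lambda_1-t-1,\lambda_1\},\min\{\lambda_1-t-1,\lambda_2\},\dots,\min\{\lambda_1-t-1,\lambda_r\})$, and where $\Delta_t^\mu=\emptyset$ for $\mu=(0,0,\dots,0)$.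
   Context: A partition $\lambda=(\lambda_1,\dots,\lambda_r)$ is a finite sequence of integers $\lambda_1\ge\lambda_2\ge\dots\ge\lambda_r\ge1$, identified with its Young diagram: a top- and left-justified array of boxes with $\lambda_j$ boxes in row $j$, row $1$ being the top row. For a positive integer $t$, fill the box in row $j$ and column $i$ ($1\le j\le r$, $1\le i\le\lambda_j$) with the integer $(r-j)t+i$. The $t$-Young complex $\Delta_t^\lambda$ is the simplicial complex whose facets are all sets $\{a_1,\dots,a_{\lambda_1}\}$ with $a_1<\dots<a_{\lambda_1}$ and such that $a_j$ is an entry of the $j$-th column of $\lambda$ for every $1\le j\le\lambda_1$. Here $\emptyset$ denotes the complex without vertices. $\Sigma(\Delta)$ is the suspension of $\Delta$ (the join of $\Delta$ with two disjoint points), with the convention $\Sigma(\emptyset)=S^0$ (hence $\Sigma^2(\emptyset)=S^1$); $\vee$ is the wedge sum and $\simeq$ is homotopy equivalence. Simplicial complexes are identified with their geometric realizations. *)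

(* Defs.v *)
From HB Require Import structures.
From mathcomp Require Import all_boot all_order all_algebra.
From mathcomp Require Import all_classical all_reals all_analysis homotopy.
Import Order.TTheory GRing.Theory Num.Theory.
Import numFieldNormedType.Exports.

Set Implicit Arguments.
Unset Strict Implicit.
Unset Printing Implicit Defensive.

Local Open Scope classical_set_scope.
Local Open Scope ring_scope.

(* A vertex of a complex on V is a v with [set v] in faces: not every element *)
(* of V has to be one. The complex without vertices has set0 as unique face.  *)
Record simplicial_complex (V : finType) := SimplicialComplex {
  faces :> {set {set V}};
  faces_sub : forall s u : {set V}, s \subset u -> u \in faces -> s \in faces }.

Section complexes.
Variables V W : finType.

Definition generated_faces (F : {set {set V}}) : {set {set V}} :=
  [set s : {set V} | [exists u in F, s \subset u]].

Lemma generated_faces_sub (F : {set {set V}}) (s u : {set V}) :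
  s \subset u -> u \in generated_faces F -> s \in generated_faces F.
Proof.
move=> su; rewrite !inE => /exists_inP[w Fw uw].
by apply/exists_inP; exists w => //; exact: (fintype.subset_trans su uw).
Qed.

Definition generated_complex (F : {set {set V}}) :=
  SimplicialComplex (@generated_faces_sub F).

Definition join_faces (K : simplicial_complex V) (L : simplicial_complex W) :
    {set {set V + W}} :=
  [set s : {set V + W} | (inl @^-1: s \in K) && (inr @^-1: s \in L)].

Lemma join_faces_sub K L (s u : {set V + W}) :
  s \subset u -> u \in join_faces K L -> s \in join_faces K L.
Proof.
move=> su; rewrite !inE => /andP[Ku Lu]; apply/andP; split.
  by apply: faces_sub Ku; exact: preimsetS.
by apply: faces_sub Lu; exact: preimsetS.
Qed.

Definition join_complex K L := SimplicialComplex (@join_faces_sub K L).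

End complexes.

Definition two_points : simplicial_complex bool :=
  generated_complex [set [set false]; [set true]]%SET.

(* Since the empty set is a face, this sends the complex without vertices to  *)
(* two points.                                                                *)
Definition suspension (V : finType) (K : simplicial_complex V) :
    simplicial_complex (V + bool)%type :=
  join_complex K two_points.

(* Barycentric coordinates; V being finite, the product topology of R^V       *)
(* induces the usual topology.                                                *)
Definition realization (R : realType) (V : finType) (K : simplicial_complex V) :
    set (prod_topology (fun _ : V => R)) :=
  [set x | [/\ forall v, 0 <= x v, \sum_(v : V) x v = 1
             & [set v : V | x v != 0]%SET \in K]].

Arguments realization R {V} K.

Definition homotopic (R : realType) (X Y : topologicalType) (f g : X -> Y) :=
  exists H : X * R -> Y,
    [/\ {within [set: X] `*` `[0, 1], continuous H},
        forall x, H (x, 0) = f x & forall x, H (x, 1) = g x].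

Definition homotopy_equivalent (R : realType) (X Y : topologicalType) :=
  exists (f : X -> Y) (g : Y -> X),
    [/\ continuous f, continuous g,
        homotopic R (g \o f) idfun & homotopic R (f \o g) idfun].

Section wedge3.
Variables X Y Z : topologicalType.

Definition wedge3_space (i : 'I_3) : topologicalType :=
  match val i with 0%N => X | 1%N => Y | _ => Z end.

Definition wedge3_point (x : X) (y : Y) (z : Z) (i : 'I_3) : wedge3_space i :=
  match val i as n
    return (match n with 0%N => X | 1%N => Y | _ => Z end : topologicalType)
  with 0%N => x | 1%N => y | _ => z end.

Definition wedge3 (x : X) (y : Y) (z : Z) : topologicalType :=
  wedge (wedge3_point x y z).

End wedge3.

Local Open Scope nat_scope.

Definition is_partition (la : seq nat) : bool :=
  sorted geq la && all (leq 1) la.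

Section young.
Variables (t : nat) (la : seq nat).

(* Rows and columns are numbered from 0: the integer in row j and column i    *)
(* (from 1) is young_entry j.-1 i.-1, and nth 0 la 0 is the first part.       *)
Definition young_entry (j i : nat) : nat := (size la - j.+1) * t + i.+1.

Definition in_column (i x : nat) : bool :=
  [exists j : 'I_(size la), (i < nth 0 la j) && (x == young_entry j i)].

(* The entries range from 1 to (size la).-1 * t + nth 0 la 0. *)
Definition young_bound : nat := ((size la).-1 * t + nth 0 la 0).+1.

Local Notation young_vertex := 'I_young_bound.

Definition young_facets : {set {set young_vertex}} :=
  [set [set a i | i : 'I_(nth 0 la 0)]%SET
  | a : {ffun 'I_(nth 0 la 0) -> young_vertex} &
      [forall i : 'I_(nth 0 la 0), in_column i (a i)] &&
      [forall i : 'I_(nth 0 la 0), forall j : 'I_(nth 0 la 0), (i < j) ==> (a i < a j)]]%SET.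

Definition young_complex : simplicial_complex young_vertex :=
  generated_complex young_facets.

End young.

Lemma young_complex_zero (t : nat) (mu : seq nat) :
  all (eq_op 0) mu -> young_complex t mu = [set finset.set0]%SET :> {set {set _}}.
Proof.
move=> mu0; have mu00 : nth 0 mu 0 = 0 by case: mu mu0 => //= -[].
have f0 (i : 'I_(nth 0 mu 0)) : False by case: i; rewrite mu00.
apply/setP => s; rewrite !inE; apply/exists_inP/eqP => [[_ /imsetP[a _ ->]]|->].
  rewrite (_ : [set a i | i : 'I_(nth 0 mu 0)]%SET = finset.set0).
    by rewrite finset.subset0 => /eqP.
  by apply/setP => x; rewrite inE; apply/imsetP => -[i]; case: (f0 i).
pose a : {ffun 'I_(nth 0 mu 0) -> 'I_(young_bound t mu)} := [ffun=> ord0].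
exists [set a i | i : 'I_(nth 0 mu 0)]%SET; last exact: finset.sub0set.
apply/imsetP; exists a => //; rewrite inE.
by apply/andP; split; apply/forallP => i; case: (f0 i).
Qed.

(* Main.v *)
Require Import Defs.
From HB Require Import structures.
From mathcomp Require Import all_boot all_order all_algebra.
From mathcomp Require Import all_classical all_reals all_analysis.
From mathcomp Require Import homotopy zify ring lra.
Import Order.TTheory GRing.Theory Num.Theory.
Import numFieldNormedType.Exports.

(* Let n be the first part of la, let v and w be the last boxes of its first    *)
(* and second rows, and u the box to the left of w. Write A, B and C for the    *)
(* complexes of lambda', lambda'' and lambda'''. An increasing transversal      *)
(* which has entered the first row stays there, so that every facet outside A   *)
(* contains v. Sending the other entries of the first row that are not entries  *)
(* of A to v is contiguous to the identity and retracts the complex of la to    *)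
(* A u v*E with E = B u w*C. Moreover w*E lies in A and u*C lies in B: a prefix *)
(* of a transversal can always be continued along the second row. The last      *)
(* ingredient is that if w*E lies in A, then A u v*E is homotopy equivalent to  *)
(* the wedge of A at w and of the suspension of E. It applies to A and E, and   *)
(* again to the suspension of E, which is the union of those of B and of        *)
(* w*C, with u in the role of w. All these complexes being connected, the base  *)
(* points can be moved freely.                                                  *)

Set Implicit Arguments.
Unset Strict Implicit.
Unset Printing Implicit Defensive.

Local Open Scope classical_set_scope.
Local Open Scope ring_scope.

(** * Continuity *)

(** The combinatorial half rests on two facts about entries. Below the first row, the entries of
    column i (from 0) are at most q + i.+1, the second-row entry, whereas the first-row entry is q +
    t + i.+1. As t >= 1, a lower entry of a column never exceeds the first-row entry of the
    preceding column, so an increasing transversal is a lower prefix followed by a tail in the first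
    row ([column_chain_mixed], [valued_first_row]), and any lower prefix continues along the second
    row ([extend_chain]). Moreover the first-row entry of column i is the second-row entry of column
    i + t when that column exists, which puts the complex of lambda''' inside that of lambda'' and
    leaves room for u ([lower_uCB]). The retraction onto A u v*E is [K_phi].

    The topological half is [cone_attachment_rel_equiv]: the cone v*E is pinched at half height, its
    lower half is spread over w*E inside A and its upper half over the suspension of E. The inverse
    includes A and folds the suspension onto v*E u w*E. [iterated_cone_attachment_equiv] applies
    this twice. Equivalences are kept pointed so that they pass to wedges ([wedge2_equiv]), and
    [realization_base_change] moves base points along paths, which allows the arbitrary base points
    of [mixed_wedge3]. *)

Section continuity.
Variables (R : realType) (X Y : topologicalType).

Lemma closed_paste (A B : set X) (f g h : X -> Y) :
  closed A -> closed B -> A `|` B = setT -> continuous f -> continuous g ->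
  (forall x, A x -> h x = f x) -> (forall x, B x -> h x = g x) -> continuous h.
Proof.
move=> cA cB AB cf cg hf hg; apply/continuous_subspace_setT; rewrite -AB.
apply: withinU_continuous => //.
- apply: (subspace_eq_continuous (f := f)); last exact: continuous_subspaceT.
  by move=> x /set_mem/hf.
- apply: (subspace_eq_continuous (f := g)); last exact: continuous_subspaceT.
  by move=> x /set_mem/hg.
Qed.

Lemma if_continuous (u : X -> R) (f g : X -> Y) :
  continuous u -> continuous f -> continuous g ->
  (forall x, u x = 0 -> f x = g x) ->
  continuous (fun x => if u x <= 0 then f x else g x).
Proof.
move=> cu cf cg fg.
apply: (@closed_paste (u @^-1` [set y | y <= 0]) (u @^-1` [set y | 0 <= y]) f g).
- by apply: preimage_closed; [move=> x _; exact: cu | exact: closed_le].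
- by apply: preimage_closed; [move=> x _; exact: cu | exact: closed_ge].
- by apply/seteqP; split=> // x _ /=; case: (leP (u x) 0) => [|/ltW]; [left|right].
- exact: cf.
- exact: cg.
- by move=> x /= ->.
- by move=> x /= u0; case: (leP (u x) 0) => // u0'; apply: fg; apply/le_anti/andP.
Qed.

Lemma addr_continuous (f g : X -> R) :
  continuous f -> continuous g -> continuous (fun x => f x + g x).
Proof. by move=> cf cg x; apply: cvgD; [exact: cf|exact: cg]. Qed.

Lemma oppr_continuous (f : X -> R) : continuous f -> continuous (fun x => - f x).
Proof. by move=> cf x; apply: cvgN; exact: cf. Qed.

Lemma mulr_continuous (f g : X -> R) :
  continuous f -> continuous g -> continuous (fun x => f x * g x).
Proof. by move=> cf cg x; apply: cvgM; [exact: cf|exact: cg]. Qed.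

Lemma invr_continuous (f : X -> R) :
  (forall x, f x != 0) -> continuous f -> continuous (fun x => (f x)^-1).
Proof. by move=> f0 cf x; apply: cvgV => //; exact: cf. Qed.

Lemma maxr_continuous (f g : X -> R) :
  continuous f -> continuous g -> continuous (fun x => Num.max (f x) (g x)).
Proof.
by move=> cf cg x; apply: (@continuous_max R X f g); [exact: cf|exact: cg].
Qed.

Lemma minr_continuous (f g : X -> R) :
  continuous f -> continuous g -> continuous (fun x => Num.min (f x) (g x)).
Proof.
by move=> cf cg x; apply: (@continuous_min R X f g); [exact: cf|exact: cg].
Qed.

Lemma normr_continuous (f : X -> R) : continuous f -> continuous (fun x => `|f x|).
Proof. by move=> cf x; apply: cvg_norm; exact: cf. Qed.

Lemma sumr_continuous (I : finType) (P : pred I) (f : I -> X -> R) :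
  (forall i, continuous (f i)) -> continuous (fun x => \sum_(i | P i) f i x).
Proof.
move=> cf; apply: continuous_big => [|i _]; last exact: cf.
exact: add_continuous.
Qed.

Lemma pair_continuous (Z : topologicalType) (f : X -> Y) (g : X -> Z) :
  continuous f -> continuous g -> continuous (fun x => (f x, g x)).
Proof. by move=> cf cg x; apply: cvg_pair; [exact: cf|exact: cg]. Qed.

Lemma comp_continuous (Z : topologicalType) (f : X -> Y) (g : Y -> Z) :
  continuous f -> continuous g -> continuous (fun x => g (f x)).
Proof. by move=> cf cg x; apply: continuous_comp; [exact: cf|exact: cg]. Qed.

Lemma id_continuous : continuous (fun x : X => x).
Proof. by move=> x; exact: cvg_id. Qed.

Lemma fst_continuous : continuous (fun p : X * Y => p.1).
Proof. by move=> p; exact: cvg_fst. Qed.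

Lemma snd_continuous : continuous (fun p : X * Y => p.2).
Proof. by move=> p; exact: cvg_snd. Qed.

Lemma fst_comp_continuous (Z : topologicalType) (f : X -> Y * Z) :
  continuous f -> continuous (fun x => (f x).1).
Proof. by move=> cf x; apply: continuous_comp; [exact: cf|exact: cvg_fst]. Qed.

Lemma snd_comp_continuous (Z : topologicalType) (f : X -> Y * Z) :
  continuous f -> continuous (fun x => (f x).2).
Proof. by move=> cf x; apply: continuous_comp; [exact: cf|exact: cvg_snd]. Qed.

Lemma sub_continuous (A : set Y) (f : X -> A) :
  continuous (fun x => set_val (f x)) -> continuous f.
Proof. by move=> cf; apply: continuous_comp_initial. Qed.

Lemma val_comp_continuous (A : set Y) (f : X -> A) :
  continuous f -> continuous (fun x => set_val (f x)).
Proof.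
move=> cf x; apply: (@continuous_comp _ _ _ f set_val); first exact: cf.
exact: initial_continuous.
Qed.

Lemma ptws_continuous (V : Type) (f : X -> prod_topology (fun _ : V => R)) :
  (forall v, continuous (fun x => f x v)) -> continuous f.
Proof.
move=> cf x; apply/cvg_sup => v; apply: (@cvg_trans _ (nbhs (f x : initial_topology (fun g : V -> R => g v)))).
  exact: (@continuous_comp_initial _ _ _ (fun g : V -> R => g v) f (cf v) x).
exact: cvg_id.
Qed.

Lemma coord_continuous (V : eqType) (f : X -> prod_topology (fun _ : V => R)) v :
  continuous f -> continuous (fun x => f x v).
Proof.
move=> cf x; apply: (@continuous_comp _ _ _ f (fun g => g v)); first exact: cf.
exact: (@proj_continuous _ (fun=> R) v).
Qed.

End continuity.

(** * Pointed homotopy equivalences and wedges *)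

Definition set_pt (T : Type) (A : set T) (x : T) (Ax : A x) : A :=
  exist (fun y => y \in A) x (mem_set Ax).

Lemma set_pt_inj (T : Type) (A : set T) (a b : A) : set_val a = set_val b -> a = b.
Proof. exact: val_inj. Qed.

Lemma set_ptE (T : Type) (A : set T) (x : T) (Ax : A x) : set_val (set_pt Ax) = x.
Proof. by []. Qed.

Lemma set_ptP (T : Type) (A : set T) (a : A) : A (set_val a).
Proof. exact: set_valP. Qed.

Section pointed_homotopy.
Variable R : realType.

(** Retraction of the line onto [0, 1]. With it homotopies are defined for all times in [R], and no
    subspace topology on the interval has to be handled. *)
Definition clip (s : R) : R := Num.max 0 (Num.min 1 s).

Lemma clip_ge0 s : 0 <= clip s. Proof. by rewrite /clip le_max lexx. Qed.
Lemma clip_le1 s : clip s <= 1.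
Proof. by rewrite /clip ge_max ler01 /= ge_min lexx. Qed.
Lemma clip_eq0 s : s <= 0 -> clip s = 0.
Proof. by move=> s0; apply/max_idPl; rewrite ge_min s0 orbT. Qed.
Lemma clip_eq1 s : 1 <= s -> clip s = 1.
Proof. by move=> s1; rewrite /clip (min_idPl s1); apply/max_idPr/ler01. Qed.
Lemma clip_continuous (X : topologicalType) (f : X -> R) :
  continuous f -> continuous (fun x => clip (f x)).
Proof.
move=> cf; apply: maxr_continuous; first exact: cst_continuous.
by apply: minr_continuous => //; exact: cst_continuous.
Qed.

(* Homotopies relative to a base point, extended constantly outside [0, 1]. *)
Definition homotopic_rel (X Y : topologicalType) (x0 : X) (y0 : Y) (f g : X -> Y) :=
  exists H : X * R -> Y,
    [/\ continuous H, forall x s, s <= 0 -> H (x, s) = f x,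
        forall x s, 1 <= s -> H (x, s) = g x & forall s, H (x0, s) = y0].

Definition pointed_equiv (X Y : topologicalType) (x0 : X) (y0 : Y) :=
  exists (f : X -> Y) (g : Y -> X),
    [/\ continuous f, continuous g, f x0 = y0, g y0 = x0 &
        homotopic_rel x0 x0 (g \o f) idfun /\ homotopic_rel y0 y0 (f \o g) idfun].

Section homotopic_rel_theory.
Variables X Y Z T : topologicalType.
Implicit Types (x : X) (y : Y).

Lemma homotopic_rel_refl x0 y0 (f : X -> Y) :
  continuous f -> f x0 = y0 -> homotopic_rel x0 y0 f f.
Proof.
move=> cf f0; exists (fun p => f p.1); split => //.
by apply: (comp_continuous _ cf); exact: fst_continuous.
Qed.

Lemma homotopic_rel_unit x0 y0 (f g : X -> Y) (H : X * R -> Y) :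
  continuous H -> (forall x, H (x, 0) = f x) -> (forall x, H (x, 1) = g x) ->
  (forall s, H (x0, s) = y0) -> homotopic_rel x0 y0 f g.
Proof.
move=> cH H0 H1 Hx; exists (fun p => H (p.1, clip p.2)); split => //.
- apply: (comp_continuous _ cH); apply: pair_continuous.
    exact: fst_continuous.
  by apply: clip_continuous; exact: snd_continuous.
- by move=> x s s0 /=; rewrite clip_eq0.
- by move=> x s s1 /=; rewrite clip_eq1.
Qed.

Lemma homotopic_rel_trans x0 y0 (f g h : X -> Y) :
  homotopic_rel x0 y0 f g -> homotopic_rel x0 y0 g h -> homotopic_rel x0 y0 f h.
Proof.
move=> [H [cH H0 H1 Hx]] [K [cK K0 K1 Kx]].
exists (fun p => if p.2 - 2^-1 <= 0 then H (p.1, p.2 * 2) else K (p.1, p.2 * 2 - 1)).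
split.
- have c2 : continuous (fun p : X * R => p.2) by exact: snd_continuous.
  have c1 : continuous (fun p : X * R => p.1) by exact: fst_continuous.
  apply: if_continuous.
  + by apply: addr_continuous => //; exact: cst_continuous.
  + apply: (comp_continuous _ cH); apply: pair_continuous => //.
    by apply: mulr_continuous => //; exact: cst_continuous.
  + apply: (comp_continuous _ cK); apply: pair_continuous => //.
    apply: addr_continuous; last exact: cst_continuous.
    by apply: mulr_continuous => //; exact: cst_continuous.
  + by move=> [x s] /= s2; rewrite H1 ?K0 //; lra.
- by move=> x s s0 /=; rewrite ifT ?H0 //; lra.
- by move=> x s s1 /=; rewrite ifF ?K1 //; [lra | apply/negbTE; rewrite -ltNge; lra].
- by move=> s /=; case: ifP.
Qed.

Lemma homotopic_rel_comp x0 y0 (z0 : Z) (t0 : T) (f g : X -> Y) (k : Y -> Z) (h : T -> X) :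
  continuous k -> k y0 = z0 -> continuous h -> h t0 = x0 ->
  homotopic_rel x0 y0 f g -> homotopic_rel t0 z0 (k \o f \o h) (k \o g \o h).
Proof.
move=> ck k0 ch h0 [H [cH H0 H1 Hx]].
exists (fun p => k (H (h p.1, p.2))); split.
- apply: (comp_continuous _ ck); apply: (comp_continuous _ cH).
  apply: pair_continuous; last exact: snd_continuous.
  by apply: (comp_continuous _ ch); exact: fst_continuous.
- by move=> x s s0 /=; rewrite H0.
- by move=> x s s1 /=; rewrite H1.
- by move=> s /=; rewrite h0 Hx.
Qed.

End homotopic_rel_theory.

Lemma pointed_equiv_sym (X Y : topologicalType) (x0 : X) (y0 : Y) :
  pointed_equiv x0 y0 -> pointed_equiv y0 x0.
Proof.
move=> [f [g [cf cg f0 g0 [fg gf]]]]; exists g, f.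
by split.
Qed.

Lemma pointed_equiv_trans (X Y Z : topologicalType) (x0 : X) (y0 : Y) (z0 : Z) :
  pointed_equiv x0 y0 -> pointed_equiv y0 z0 -> pointed_equiv x0 z0.
Proof.
move=> [f [g [cf cg f0 g0 [gf fg]]]] [h [k [ch ck h0 k0 [kh hk]]]].
exists (h \o f), (g \o k); split.
- exact: comp_continuous.
- exact: comp_continuous.
- by rewrite /= f0.
- by rewrite /= k0.
- split.
  + apply: homotopic_rel_trans gf.
    exact: (homotopic_rel_comp cg g0 cf f0 kh).
  + apply: homotopic_rel_trans hk.
    exact: (homotopic_rel_comp ch h0 ck k0 fg).
Qed.

Lemma pointed_equiv_refl (X : topologicalType) (x0 : X) : pointed_equiv x0 x0.
Proof.
exists idfun, idfun; split => //; try exact: id_continuous.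
by split; apply: homotopic_rel_refl => //; exact: id_continuous.
Qed.

Lemma pointed_equiv_homeo (X Y : topologicalType) (x0 : X) (f : X -> Y) (g : Y -> X) :
  continuous f -> continuous g -> cancel f g -> cancel g f ->
  pointed_equiv x0 (f x0).
Proof.
move=> cf cg fg gf; exists f, g; split => //; split.
  have -> : g \o f = idfun by apply/funext.
  by apply: homotopic_rel_refl => //; exact: id_continuous.
have -> : f \o g = idfun by apply/funext.
by apply: homotopic_rel_refl => //; exact: id_continuous.
Qed.

Lemma homotopic_rel_homotopic (X Y : topologicalType) (x0 : X) (y0 : Y) (f g : X -> Y) :
  homotopic_rel x0 y0 f g -> homotopic R f g.
Proof.
move=> [H [cH H0 H1 _]]; exists H; split.
- exact: continuous_subspaceT.
- by move=> x; rewrite H0.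
- by move=> x; rewrite H1.
Qed.

Lemma pointed_equiv_homotopy_equivalent (X Y : topologicalType) (x0 : X) (y0 : Y) :
  pointed_equiv x0 y0 -> homotopy_equivalent R X Y.
Proof.
move=> [f [g [cf cg _ _ [gf fg]]]]; exists f, g; split => //.
- exact: homotopic_rel_homotopic gf.
- exact: homotopic_rel_homotopic fg.
Qed.

End pointed_homotopy.

(** * Wedges of two pointed spaces *)

Section wedge2.
Variable R : realType.

(** The wedge is taken as the union of the two axes in the product instead of a quotient: continuity
    into it is checked coordinatewise, and a pair of homotopies relative to the base points
    restricts to it. *)
Definition wedge2 (X Y : topologicalType) (x : X) (y : Y) : set (X * Y) :=
  [set p | p.1 = x \/ p.2 = y].

Definition wedge2_base (X Y : topologicalType) (x : X) (y : Y) : wedge2 x y :=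
  set_pt (or_introl erefl : wedge2 x y (x, y)).

Lemma wedge2_map_subproof (X Y X' Y' : topologicalType) (x : X) (y : Y) (x' : X') (y' : Y')
    (f : X -> X') (g : Y -> Y') :
  f x = x' -> g y = y' -> forall p : wedge2 x y, wedge2 x' y' (f (set_val p).1, g (set_val p).2).
Proof. by move=> fx gy p; case: (set_ptP p) => ->; [left|right]. Qed.

Definition wedge2_map (X Y X' Y' : topologicalType) (x : X) (y : Y) (x' : X') (y' : Y')
    (f : X -> X') (g : Y -> Y') (fx : f x = x') (gy : g y = y') (p : wedge2 x y) :
    wedge2 x' y' :=
  set_pt (wedge2_map_subproof fx gy p).

Lemma wedge2_map_continuous (X Y X' Y' : topologicalType) (x : X) (y : Y) (x' : X') (y' : Y')
    (f : X -> X') (g : Y -> Y') (fx : f x = x') (gy : g y = y') :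
  continuous f -> continuous g -> continuous (wedge2_map fx gy).
Proof.
move=> cf cg; apply: sub_continuous; apply: pair_continuous.
- by apply: (comp_continuous _ cf); apply: fst_comp_continuous; apply: val_comp_continuous; exact: id_continuous.
- by apply: (comp_continuous _ cg); apply: snd_comp_continuous; apply: val_comp_continuous; exact: id_continuous.
Qed.

Lemma wedge2_map_homotopic (X Y : topologicalType) (x : X) (y : Y)
    (f : X -> X) (g : Y -> Y) (k : wedge2 x y -> wedge2 x y) :
  (forall p, set_val (k p) = (f (set_val p).1, g (set_val p).2)) ->
  homotopic_rel R x x f idfun -> homotopic_rel R y y g idfun ->
  homotopic_rel R (wedge2_base x y) (wedge2_base x y) k idfun.
Proof.
move=> kE [H [cH H0 H1 Hx]] [K [cK K0 K1 Ky]].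
have P (p : wedge2 x y * R) :
    wedge2 x y (H ((set_val p.1).1, p.2), K ((set_val p.1).2, p.2)).
  by case: (set_ptP p.1) => ->; [left; exact: Hx|right; exact: Ky].
exists (fun p => set_pt (P p)); split.
- apply: sub_continuous; apply: pair_continuous.
  + apply: (comp_continuous _ cH); apply: pair_continuous; last exact: snd_continuous.
    apply: fst_comp_continuous; apply: val_comp_continuous.
    exact: fst_continuous.
  + apply: (comp_continuous _ cK); apply: pair_continuous; last exact: snd_continuous.
    apply: snd_comp_continuous; apply: val_comp_continuous.
    exact: fst_continuous.
- by move=> p s s0; apply: set_pt_inj; rewrite kE set_ptE /= H0 ?K0.
- by move=> p s s1; apply: set_pt_inj; rewrite set_ptE /= H1 ?K1 //; case: (set_val p).
- by move=> s; apply: set_pt_inj; rewrite !set_ptE /= Hx Ky.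
Qed.

Lemma wedge2_equiv (X Y X' Y' : topologicalType) (x : X) (y : Y) (x' : X') (y' : Y') :
  pointed_equiv R x x' -> pointed_equiv R y y' ->
  pointed_equiv R (wedge2_base x y) (wedge2_base x' y').
Proof.
move=> [f [f' [cf cf' fx fx' [f'f ff']]]] [g [g' [cg cg' gy gy' [g'g gg']]]].
exists (wedge2_map fx gy), (wedge2_map fx' gy'); split.
- exact: wedge2_map_continuous.
- exact: wedge2_map_continuous.
- by apply: set_pt_inj; rewrite !set_ptE /= fx gy.
- by apply: set_pt_inj; rewrite !set_ptE /= fx' gy'.
- split.
  + exact: (@wedge2_map_homotopic _ _ _ _ (f' \o f) (g' \o g)).
  + exact: (@wedge2_map_homotopic _ _ _ _ (f \o f') (g \o g')).
Qed.

End wedge2.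

(** * The threefold quotient wedge as an iterated union of axes *)

Section wedge3_of_wedge2.
Variables (R : realType) (X Y Z : topologicalType) (x : X) (y : Y) (z : Z).

Let W := wedge2 x (wedge2_base y z).

Definition wedge3_fun (T : Type) (f : X -> T) (g : Y -> T) (h : Z -> T) (i : 'I_3) :
    wedge3_space X Y Z i -> T :=
  match val i as n
    return ((match n with 0%N => X | 1%N => Y | _ => Z end : topologicalType) -> T)
  with 0%N => f | 1%N => g | _ => h end.

Definition wedge3_in (i : 'I_3) : wedge3_space X Y Z i -> wedge3 x y z :=
  @wedge_lift _ _ (wedge3_point x y z) i.

Let i0 : 'I_3 := Ordinal (isT : 0 < 3)%N.
Let i1 : 'I_3 := Ordinal (isT : 1 < 3)%N.
Let i2 : 'I_3 := Ordinal (isT : 2 < 3)%N.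

Let in0 : X -> wedge3 x y z := wedge3_in (i := i0).
Let in1 : Y -> wedge3 x y z := wedge3_in (i := i1).
Let in2 : Z -> wedge3 x y z := wedge3_in (i := i2).

Let in_continuous : [/\ continuous in0, continuous in1 & continuous in2].
Proof.
have H := @wedge_lift_continuous _ _ (wedge3_point x y z).
by split; [exact: (H i0) | exact: (H i1) | exact: (H i2)].
Qed.

Let in_base : in0 x = in1 y /\ in1 y = in2 z.
Proof.
split.
- exact: (@wedge_liftE _ _ (wedge3_point x y z) i1 y i0 x).
- exact: (@wedge_liftE _ _ (wedge3_point x y z) i2 z i1 y).
Qed.

Let pt2 (b : Y) : W := set_pt (or_introl erefl : W (x, set_pt (or_intror erefl : wedge2 y z (b, z)))).
Let pt3 (c : Z) : W := set_pt (or_introl erefl : W (x, set_pt (or_introl erefl : wedge2 y z (y, c)))).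
Let pt1 (a : X) : W := set_pt (or_intror erefl : W (a, wedge2_base y z)).

Let pt_base : pt1 x = pt2 y /\ pt2 y = pt3 z.
Proof.
by split; apply: set_pt_inj => //=; congr (_, _); apply: set_pt_inj.
Qed.

Let of_w3 : wedge3 x y z -> W := wedge_fun (wedge3_fun pt1 pt2 pt3).

Let of_w3_point (i j : 'I_3) : wedge3_fun pt1 pt2 pt3 (wedge3_point x y z i) =
  wedge3_fun pt1 pt2 pt3 (wedge3_point x y z j).
Proof.
have [e1 e2] := pt_base.
suff H (k : 'I_3) : wedge3_fun pt1 pt2 pt3 (wedge3_point x y z k) = pt1 x by rewrite !H.
by case: k => -[|[|[|]]] // ?; rewrite /wedge3_fun /wedge3_point /= e1 // e2.
Qed.

Let of_w3_continuous : continuous of_w3.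
Proof.
apply: wedge_fun_continuous; last exact: of_w3_point.
case=> -[|[|[|]]] // ?; rewrite /wedge3_fun /=; apply: sub_continuous;
  apply: pair_continuous; try exact: cst_continuous; try (exact: id_continuous).
- apply: sub_continuous; apply: pair_continuous; last exact: cst_continuous.
  exact: id_continuous.
- apply: sub_continuous; apply: pair_continuous; first exact: cst_continuous.
  exact: id_continuous.
Qed.

(** The tests against the base points decide which axis carries the point; where two axes meet the
    branches agree by [in_base]. Continuity follows by pasting along the axes, which are closed
    because the base points are. *)
Let to_w3 (p : W) : wedge3 x y z :=
  if pselect ((set_val p).1 = x) then
    let q := set_val (set_val p).2 in
    if pselect (q.1 = y) then in2 q.2 else in1 q.1
  else in0 (set_val p).1.

Let to_w3_continuous : closed [set x] -> closed [set y] -> closed [set z] -> continuous to_w3.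
Proof.
move=> cx cy cz; have [e1 e2] := in_base; have [ci0 ci1 ci2] := in_continuous.
have cW1 : continuous (fun p : W => (set_val p).1).
  by apply: fst_comp_continuous; apply: val_comp_continuous; exact: id_continuous.
have cW2 : continuous (fun p : W => set_val (set_val p).2).
  by apply: val_comp_continuous; apply: snd_comp_continuous; apply: val_comp_continuous; exact: id_continuous.
have cW21 : continuous (fun p : W => (set_val (set_val p).2).1).
  by apply: fst_comp_continuous.
have cW22 : continuous (fun p : W => (set_val (set_val p).2).2).
  by apply: snd_comp_continuous.
pose to_w3' (p : W) := if pselect ((set_val (set_val p).2).1 = y)
  then in2 (set_val (set_val p).2).2 else in1 (set_val (set_val p).2).1.
have cpre (T : topologicalType) (k : W -> T) (t : T) :
    continuous k -> closed [set t] -> closed [set p | k p = t].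
  by move=> ck ct; apply: (@preimage_closed _ _ k [set t]) => // p _; exact: ck.
have cto_w3' : continuous to_w3'.
  apply: (@closed_paste _ _ [set p : W | (set_val (set_val p).2).1 = y]
    [set p : W | (set_val (set_val p).2).2 = z]
    (fun p => in2 (set_val (set_val p).2).2)
    (fun p => in1 (set_val (set_val p).2).1)).
  - exact: cpre.
  - exact: cpre.
  - by apply/seteqP; split => // p _; exact: (set_ptP (set_val p).2).
  - exact: (comp_continuous cW22 ci2).
  - exact: (comp_continuous cW21 ci1).
  - by move=> p /= py; rewrite /to_w3'; case: pselect.
  - by move=> p /= pz; rewrite /to_w3'; case: pselect => //= ->; rewrite pz e2.
have cy2 : closed [set p : W | (set_val p).2 = wedge2_base y z].
  rewrite (_ : mkset _ = [set p : W | (set_val (set_val p).2).1 = y] `&`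
    [set p : W | (set_val (set_val p).2).2 = z]).
    by apply: closedI; exact: cpre.
  apply/seteqP; split=> [p /= ->//|p /= [p1 p2]].
  by apply: set_pt_inj; rewrite [LHS]surjective_pairing p1 p2.
apply: (@closed_paste _ _ [set p : W | (set_val p).1 = x]
    [set p : W | (set_val p).2 = wedge2_base y z]
    to_w3' (fun p => in0 (set_val p).1)).
- exact: cpre.
- exact: cy2.
- by apply/seteqP; split => // p _; exact: (set_ptP p).
- exact: cto_w3'.
- exact: (comp_continuous cW1 ci0).
- by move=> p /= px; rewrite /to_w3; case: pselect.
- move=> p /= py; rewrite /to_w3; case: pselect => //= px.
  have -> : set_val (set_val p).2 = (y, z) by rewrite py.
  by case: pselect => //= _; rewrite px e1 e2.
Qed.

Let of_w3_in0 a : of_w3 (in0 a) = pt1 a.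
Proof. exact: (@wedge_lift_funE _ _ _ _ (wedge3_fun pt1 pt2 pt3) i0 a of_w3_point). Qed.
Let of_w3_in1 a : of_w3 (in1 a) = pt2 a.
Proof. exact: (@wedge_lift_funE _ _ _ _ (wedge3_fun pt1 pt2 pt3) i1 a of_w3_point). Qed.
Let of_w3_in2 a : of_w3 (in2 a) = pt3 a.
Proof. exact: (@wedge_lift_funE _ _ _ _ (wedge3_fun pt1 pt2 pt3) i2 a of_w3_point). Qed.

Let to_w3K : cancel to_w3 of_w3.
Proof.
move=> p; rewrite /to_w3; case: pselect => [p1|p1]; last first.
  rewrite of_w3_in0; apply: set_pt_inj; rewrite set_ptE [RHS]surjective_pairing.
  by case: (set_ptP p) => [//|->].
case: pselect => [p2|p2].
  rewrite of_w3_in2; apply: set_pt_inj; rewrite set_ptE [RHS]surjective_pairing p1.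
  congr (_, _); apply: set_pt_inj.
  by rewrite set_ptE [RHS]surjective_pairing p2.
rewrite of_w3_in1; apply: set_pt_inj; rewrite set_ptE [RHS]surjective_pairing p1.
congr (_, _); apply: set_pt_inj; rewrite set_ptE [RHS]surjective_pairing.
by case: (set_ptP (set_val p).2) => [//|->].
Qed.

Let of_w3K : cancel of_w3 to_w3.
Proof.
have [e1 e2] := in_base.
move=> w; have : (\bigcup_i (@wedge_lift _ _ (wedge3_point x y z) i) @` setT) w.
  by rewrite wedgeTE.
case=> i _ [v _ <-].
case: i v => -[|[|[|//]]] lti v.
(* The bound proof inside the index must become the canonical one before [in0] is recognised. *)
- have -> : wedge_lift (wedge3_point x y z) v = in0 v.
    by rewrite /in0 /wedge3_in /i0; move: v; rewrite (bool_irrelevance lti isT).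
  rewrite of_w3_in0 /to_w3 /=; case: pselect => //= vx; case: pselect => //= _.
  by rewrite vx e1 e2.
- have -> : wedge_lift (wedge3_point x y z) v = in1 v.
    by rewrite /in1 /wedge3_in /i1; move: v; rewrite (bool_irrelevance lti isT).
  rewrite of_w3_in1 /to_w3 /=; case: pselect => //= _; case: pselect => //= vy.
  by rewrite vy e2.
- have -> : wedge_lift (wedge3_point x y z) v = in2 v.
    by rewrite /in2 /wedge3_in /i2; move: v; rewrite (bool_irrelevance lti isT).
  by rewrite of_w3_in2 /to_w3 /=; case: pselect => //= _; case: pselect.
Qed.

Lemma wedge3_equiv : closed [set x] -> closed [set y] -> closed [set z] ->
  exists p : wedge3 x y z, pointed_equiv R (wedge2_base x (wedge2_base y z)) p.
Proof.
move=> cx cy cz; exists (to_w3 (wedge2_base x (wedge2_base y z))).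
by apply: (@pointed_equiv_homeo R _ _ _ to_w3 of_w3) => //; exact: to_w3_continuous.
Qed.

End wedge3_of_wedge2.

(** * Change of base point *)

Section whisker.
Variables (R : realType) (X : topologicalType).
Implicit Type x : X.

Definition joined x y := exists g : R -> X,
  [/\ continuous g, forall s, s <= 0 -> g s = x & forall s, 1 <= s -> g s = y].

Lemma joined_sym x y : joined x y -> joined y x.
Proof.
move=> [g [cg g0 g1]]; exists (fun s => g (1 - s)); split.
- apply: (comp_continuous _ cg); apply: addr_continuous; first exact: cst_continuous.
  by apply: oppr_continuous; exact: id_continuous.
- by move=> s s0; apply: g1; lra.
- by move=> s s0; apply: g0; lra.
Qed.

Lemma joined_trans x y z : joined x y -> joined y z -> joined x z.
Proof.
move=> [g [cg g0 g1]] [h [ch h0 h1]].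
exists (fun s => if s - 2^-1 <= 0 then g (s * 2) else h (s * 2 - 1)); split.
- have c2 : continuous (fun s : R => s * 2).
    by apply: mulr_continuous; [exact: id_continuous|exact: cst_continuous].
  apply: if_continuous.
  + by apply: addr_continuous; [exact: id_continuous|exact: cst_continuous].
  + exact: (comp_continuous c2 cg).
  + apply: (comp_continuous _ ch); apply: addr_continuous => //; exact: cst_continuous.
  + by move=> s s0; rewrite g1 ?h0 //; lra.
- by move=> s s0; rewrite ifT ?g0 //; lra.
- by move=> s s1; rewrite ifF ?h1 //; [lra | apply/negbTE; rewrite -ltNge; lra].
Qed.

(* X with a line attached at x: it carries a path to its base point without *)
(* any assumption on X.                                                     *)
Definition whisker x : set (X * R) := wedge2 x (1 : R).

Definition whisker_base x : whisker x := set_pt (or_introl erefl : whisker x (x, 0)).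

(* A weak form of the homotopy extension property of (X, x): a deformation of *)
(* X rel x which contracts a neighbourhood of x.                              *)
Definition well_pointed x := exists (k : X -> R) (D : X * R -> X),
  [/\ continuous k /\ k x = 0, continuous D, forall y s, s <= 0 -> D (y, s) = y,
      forall s, D (x, s) = x & forall y, k y = 1 \/ D (y, 1) = x].

Let val1_continuous x : continuous (fun p : whisker x => (set_val p).1).
Proof. by apply: fst_comp_continuous; apply: val_comp_continuous; exact: id_continuous. Qed.

Let val2_continuous x : continuous (fun p : whisker x => (set_val p).2).
Proof. by apply: snd_comp_continuous; apply: val_comp_continuous; exact: id_continuous. Qed.

Let val1fst_continuous x : continuous (fun p : whisker x * R => (set_val p.1).1).
Proof.
by apply: fst_comp_continuous; apply: val_comp_continuous; exact: fst_continuous.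
Qed.

Let val2fst_continuous x : continuous (fun p : whisker x * R => (set_val p.1).2).
Proof.
by apply: snd_comp_continuous; apply: val_comp_continuous; exact: fst_continuous.
Qed.

(** A point y goes to (D (y, 1), k y): near x, where D (y, 1) = x, it moves down the whisker, and
    elsewhere its height is 1. The inverse collapses the whisker. One composite is D (., 1), undone
    by running D backwards; for the other the height is first straightened linearly. *)
Lemma whisker_equiv x : well_pointed x -> pointed_equiv R x (whisker_base x).
Proof.
move=> [k [D [[ck kx] cD D0 Dx kD]]].
have cD1 : continuous (fun y => D (y, 1)).
  apply: (comp_continuous _ cD); apply: pair_continuous; last exact: cst_continuous.
  exact: id_continuous.
have fP y : whisker x (D (y, 1), k y) by case: (kD y) => ->; [right|left].
exists (fun y => set_pt (fP y)), (fun p => (set_val p).1); split.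
- by apply: sub_continuous; apply: pair_continuous.
- exact: val1_continuous.
- by apply: set_pt_inj; rewrite !set_ptE Dx kx.
- by [].
- split.
  + apply: (homotopic_rel_unit (H := fun p => D (p.1, 1 - p.2))).
    * apply: (comp_continuous _ cD); apply: pair_continuous; first exact: fst_continuous.
      apply: addr_continuous; first exact: cst_continuous.
      by apply: oppr_continuous; exact: snd_continuous.
    * by move=> y /=; rewrite subr0.
    * by move=> y /=; rewrite D0 // subrr.
    * by move=> s /=; rewrite Dx.
  + have mP (p : whisker x) : whisker x (D ((set_val p).1, 1), (set_val p).2).
      by case: (set_ptP p) => ->; [left; exact: Dx|right].
    apply: (@homotopic_rel_trans R _ _ _ _ _ (fun p => set_pt (mP p))).
    (* Where k is 1 the [X]-coordinate is not x, so the point already has height 1 and the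
       interpolated height stays 1. *)
    * have HP (p : whisker x * R) : whisker x
          (D ((set_val p.1).1, 1), k (set_val p.1).1 + p.2 * ((set_val p.1).2 - k (set_val p.1).1)).
        case: (kD (set_val p.1).1) => [k1|->]; last by left.
        right; rewrite /= k1; case: (set_ptP p.1) => [p1|->]; last by rewrite subrr mulr0 addr0.
        by move: k1; rewrite p1 kx => /eqP; rewrite eq_sym oner_eq0.
      apply: (homotopic_rel_unit (H := fun p => set_pt (HP p))).
      - apply: sub_continuous; apply: pair_continuous.
          exact: (comp_continuous (@val1fst_continuous x) cD1).
        have ck1 := comp_continuous (@val1fst_continuous x) ck.
        apply: addr_continuous => //; apply: mulr_continuous; first exact: snd_continuous.
        apply: addr_continuous; first exact: val2fst_continuous.
        exact: oppr_continuous.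
      - by move=> p; apply: set_pt_inj; rewrite set_ptE mul0r addr0.
      - by move=> p; apply: set_pt_inj; rewrite !set_ptE mul1r addrC subrK.
      - by move=> s; apply: set_pt_inj; rewrite !set_ptE /= Dx kx subrr mulr0 addr0.
    * have HP (p : whisker x * R) : whisker x (D ((set_val p.1).1, 1 - p.2), (set_val p.1).2).
        by case: (set_ptP p.1) => ->; [left; exact: Dx|right].
      apply: (homotopic_rel_unit (H := fun p => set_pt (HP p))).
      - apply: sub_continuous; apply: pair_continuous; last exact: val2fst_continuous.
        apply: (comp_continuous _ cD); apply: pair_continuous; first exact: val1fst_continuous.
        apply: addr_continuous; first exact: cst_continuous.
        by apply: oppr_continuous; exact: snd_continuous.
      - by move=> p; apply: set_pt_inj; rewrite !set_ptE subr0.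
      - move=> p; apply: set_pt_inj; rewrite set_ptE D0 ?subrr //=.
        by rewrite [RHS]surjective_pairing.
      - by move=> s; apply: set_pt_inj; rewrite !set_ptE /= Dx.
Qed.

Section slide.
Variables (x x' : X) (g : R -> X).
Hypotheses (clx : closed [set x]) (cg : continuous g).
Hypotheses (g0 : forall s, s <= 0 -> g s = x) (g1 : forall s, 1 <= s -> g s = x').

(** Up to height 1/2 the whisker at x is stretched over the whisker at x'; between 1/2 and 1 it
    follows g backwards, from x' to x, at height 1. The copy of [X] at height 1 is left fixed. *)
Lemma slide_subproof (p : whisker x) :
  whisker x' (if (set_val p).2 == 1 then (set_val p).1 else g (2 - 2 * (set_val p).2),
              Num.min 1 (2 * (set_val p).2)).
Proof.
case: eqP => [->|_]; first by right => /=; apply/min_idPl; lra.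
have [s2|s2] := leP (2 * (set_val p).2) 1; first by left => /=; apply: g1; lra.
by right.
Qed.

Definition slide (p : whisker x) : whisker x' := set_pt (slide_subproof p).

Lemma whisker_paste (Y Z : topologicalType) (u : Y -> whisker x) (f h : Y -> Z) :
  continuous u -> continuous f -> continuous h ->
  (forall y, (set_val (u y)).2 = 1 -> (set_val (u y)).1 = x -> f y = h y) ->
  continuous (fun y => if (set_val (u y)).2 == 1 then f y else h y).
Proof.
move=> cu cf ch fh.
apply: (@closed_paste _ _ [set y | (set_val (u y)).2 = 1] [set y | (set_val (u y)).1 = x] f h).
- apply: (@preimage_closed _ _ (fun y => (set_val (u y)).2) [set 1]).
    by move=> y _; exact: (comp_continuous cu (@val2_continuous x)).
  exact: closed_eq.
- apply: (@preimage_closed _ _ (fun y => (set_val (u y)).1) [set x]) => //.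
  by move=> y _; exact: (comp_continuous cu (@val1_continuous x)).
- by apply/seteqP; split => // y _; case: (set_ptP (u y)); [right|left].
- exact: cf.
- exact: ch.
- by move=> y /= ->; rewrite eqxx.
- by move=> y /= u1; case: eqP => // u2; exact: fh.
Qed.

Let two_sub_continuous (Y : topologicalType) (u : Y -> R) :
  continuous u -> continuous (fun y => 2 - 2 * u y).
Proof.
move=> cu; apply: addr_continuous; first exact: cst_continuous.
by apply: oppr_continuous; apply: mulr_continuous => //; exact: cst_continuous.
Qed.

Lemma slide_continuous : continuous slide.
Proof.
apply: sub_continuous; apply: pair_continuous.
- apply: (whisker_paste (u := fun p => p)).
  + exact: id_continuous.
  + exact: val1_continuous.
  + apply: (comp_continuous _ cg); apply: two_sub_continuous; exact: val2_continuous.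
  + by move=> p -> ->; rewrite g0 //; lra.
- apply: minr_continuous; first exact: cst_continuous.
  by apply: mulr_continuous; [exact: cst_continuous|exact: val2_continuous].
Qed.

Lemma slide_base : slide (whisker_base x) = whisker_base x'.
Proof.
apply: set_pt_inj; rewrite !set_ptE /= eq_sym oner_eq0 g1; last by lra.
by rewrite mulr0; congr (_, _); apply/min_idPr; lra.
Qed.

End slide.

(** The composite runs up the whisker, then along g to x' and back to x. This detour contracts along
    itself; what remains is a change of the height parameter. *)
Lemma slideK x x' (g h : R -> X) (clx : closed [set x]) (cg : continuous g)
    (g0 : forall s, s <= 0 -> g s = x) (g1 : forall s, 1 <= s -> g s = x')
    (h1 : forall s, 1 <= s -> h s = x) :
  (forall s, h s = g (1 - s)) ->
  homotopic_rel R (whisker_base x) (whisker_base x) (slide h1 \o slide g1) idfun.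
Proof.
move=> hE.
(* The parameter of g at height s: 4 s - 1 on the way out and 2 - 2 s on the way back, equal at s =
   1/2. As m <= 1 and g is x on nonpositive numbers, subtracting the time contracts the detour. *)
pose m (s : R) := Num.min (4 * s - 1) (2 - 2 * s).
have mP s : m s <= 1 /\ (4 * s <= 1 -> m s <= 0).
  by rewrite /m /Num.min; case: ifP; lra.
have MP (p : whisker x * R) : whisker x
    (if (set_val p.1).2 == 1 then (set_val p.1).1 else g (m (set_val p.1).2 - clip p.2),
     Num.min 1 (4 * (set_val p.1).2)).
  case: eqP => [->|_]; first by right => /=; apply/min_idPl; lra.
  have [s2|s2] := leP (4 * (set_val p.1).2) 1; last by right.
  by left => /=; apply: g0; have := clip_ge0 p.2; have := (mP (set_val p.1).2).2 s2; lra.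
have NP (p : whisker x * R) : whisker x ((set_val p.1).1,
    (1 - p.2) * Num.min 1 (4 * (set_val p.1).2) + p.2 * (set_val p.1).2).
  case: (set_ptP p.1) => ->; first by left.
  by right; rewrite /= (_ : Num.min 1 _ = 1); [lra|apply/min_idPl; lra].
have c4 : continuous (fun p : whisker x * R => Num.min 1 (4 * (set_val p.1).2)).
  apply: minr_continuous; first exact: cst_continuous.
  by apply: mulr_continuous; [exact: cst_continuous|exact: val2fst_continuous].
apply: (@homotopic_rel_trans R _ _ _ _ _ (fun p => set_pt (NP (p, 0)))).
- apply: (homotopic_rel_unit (H := fun p => set_pt (MP p))).
  + apply: sub_continuous; apply: pair_continuous => //.
    apply: (whisker_paste clx (u := fun p => p.1)).
    * exact: fst_continuous.
    * exact: val1fst_continuous.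
    * apply: (comp_continuous _ cg); apply: addr_continuous.
        apply: minr_continuous; apply: addr_continuous; try exact: cst_continuous.
          by apply: mulr_continuous; [exact: cst_continuous|exact: val2fst_continuous].
        apply: oppr_continuous.
        by apply: mulr_continuous; [exact: cst_continuous|exact: val2fst_continuous].
      by apply: oppr_continuous; apply: clip_continuous; exact: snd_continuous.
    * move=> p p2 p1; rewrite p2 p1 g0 //; have := clip_ge0 p.2.
      by rewrite /m /Num.min; case: ifP; lra.
  + move=> p; apply: set_pt_inj; rewrite !set_ptE /=.
    have [p2|p2] := eqVneq (set_val p).2 1.
      by rewrite p2 !(min_idPl _) ?eqxx //; lra.
    have [s2|s2] := leP (2 * (set_val p).2) 1; last first.
      rewrite eqxx; congr (_, _).
        by congr g; rewrite /m clip_eq0 // /Num.min; case: ifP; lra.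
      by rewrite !(min_idPl _) //; lra.
    case: eqP => [s2'|_].
      have -> : (set_val p).2 = 2^-1 by lra.
      by congr (_, _); [congr g; rewrite /m clip_eq0 // /Num.min; case: ifP; lra|rewrite !(min_idPl _) //; lra].
    congr (_, _); last by rewrite mulrA -natrM.
    by rewrite hE; congr g; rewrite /m clip_eq0 // /Num.min; case: ifP; lra.
  + move=> p; apply: set_pt_inj; rewrite !set_ptE /= subr0 mul1r mul0r addr0; congr (_, _).
    case: eqP => // p2; rewrite clip_eq1 // g0; last by have := (mP (set_val p).2).1; lra.
    by case: (set_ptP p).
  + move=> s; apply: set_pt_inj; rewrite !set_ptE /= eq_sym oner_eq0 mulr0 g0.
      by congr (_, _); apply/min_idPr; lra.
    by have := (mP 0).2; rewrite mulr0 => /(_ ler01); have := clip_ge0 s; lra.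
- apply: (homotopic_rel_unit (H := fun p => set_pt (NP p))).
  + apply: sub_continuous; apply: pair_continuous; first exact: val1fst_continuous.
    apply: addr_continuous; apply: mulr_continuous.
    * apply: addr_continuous; first exact: cst_continuous.
      by apply: oppr_continuous; exact: snd_continuous.
    * exact: c4.
    * exact: snd_continuous.
    * exact: val2fst_continuous.
  + by [].
  + move=> p; apply: set_pt_inj; rewrite !set_ptE /= subrr mul0r mul1r add0r.
    by rewrite [RHS]surjective_pairing.
  + move=> s; apply: set_pt_inj; rewrite !set_ptE /= !mulr0 (min_idPr _) ?mulr0 ?addr0 //.
Qed.

Lemma well_pointed_equiv x x' : closed [set x] -> closed [set x'] ->
  well_pointed x -> well_pointed x' -> joined x x' -> pointed_equiv R x x'.
Proof.
move=> cx cx' wx wx' [g [cg g0 g1]].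
apply: (pointed_equiv_trans (whisker_equiv wx)).
apply: (pointed_equiv_trans _ (pointed_equiv_sym (whisker_equiv wx'))).
pose h s := g (1 - s).
have ch : continuous h.
  apply: (comp_continuous _ cg); apply: addr_continuous; first exact: cst_continuous.
  by apply: oppr_continuous; exact: id_continuous.
have h0 s : s <= 0 -> h s = x' by move=> s0; apply: g1; lra.
have h1 s : 1 <= s -> h s = x by move=> s0; apply: g0; lra.
exists (slide g1), (slide h1); split.
- exact: slide_continuous.
- exact: slide_continuous.
- exact: slide_base.
- exact: slide_base.
- split; first exact: slideK.
  by apply: slideK => // s; rewrite /h; congr g; lra.
Qed.

End whisker.

(** * Realizations *)

Section realization.
Variables (R : realType) (V : finType).
Implicit Types (K : simplicial_complex V) (a b : V -> R).

Definition supp a : {set V} := [set v | a v != 0]%SET.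

Definition barycentric a := (forall v, 0 <= a v) /\ \sum_v a v = 1.

Lemma realizationP K a : realization R K a <-> barycentric a /\ supp a \in K.
Proof. by split=> [[? ? ?]|[[? ?] ?]]. Qed.

Lemma not_supp a v : v \notin supp a -> a v = 0.
Proof. by rewrite inE negbK => /eqP. Qed.

Lemma supp_subP a (s : {set V}) :
  reflect (forall v, v \notin s -> a v = 0) (supp a \subset s).
Proof.
apply: (iffP idP) => [/fintype.subsetP sas v vs|H].
  by apply: not_supp; apply: contra vs; exact: sas.
by apply/fintype.subsetP => v; rewrite inE; apply: contraR => /H ->.
Qed.

Lemma barycentric_le1 a v : barycentric a -> a v <= 1.
Proof.
by move=> [a0 <-]; rewrite (bigD1 v) //= lerDl; apply: sumr_ge0.
Qed.

Lemma barycentric_supp a : barycentric a -> exists v, v \in supp a.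
Proof.
move=> [a0 a1]; apply/set0Pn/negP => /eqP s0.
have /eqP := a1; rewrite big1 ?(eq_sym 0) ?oner_eq0 // => v _.
by apply: not_supp; rewrite s0 inE.
Qed.

Definition segment a b (s : R) : V -> R := fun v => (1 - s) * a v + s * b v.

Lemma segment0 a b : segment a b 0 = a.
Proof. by apply/funext => v; rewrite /segment subr0 mul1r mul0r addr0. Qed.
Lemma segment1 a b : segment a b 1 = b.
Proof. by apply/funext => v; rewrite /segment subrr mul1r mul0r add0r. Qed.
Lemma segmentxx a s : segment a a s = a.
Proof. by apply/funext => v; rewrite /segment -mulrDl subrK mul1r. Qed.

Lemma segment_supp a b s : supp (segment a b s) \subset supp a :|: supp b.
Proof.
apply/supp_subP => v; rewrite inE negb_or => /andP[/not_supp av /not_supp bv].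
by rewrite /segment av bv !mulr0 addr0.
Qed.

Lemma segment_barycentric a b s :
  barycentric a -> barycentric b -> 0 <= s <= 1 -> barycentric (segment a b s).
Proof.
move=> [a0 a1] [b0 b1] /andP[s0 s1]; split.
  by move=> v; apply: addr_ge0; apply: mulr_ge0 => //; rewrite subr_ge0.
by rewrite /segment big_split /= -!mulr_sumr a1 b1 !mulr1 subrK.
Qed.

Lemma segment_realization K a b s (t : {set V}) :
  barycentric a -> barycentric b -> t \in K -> supp a \subset t -> supp b \subset t ->
  0 <= s <= 1 -> realization R K (segment a b s).
Proof.
move=> ba bb tK sat sbt s01; apply/realizationP; split; first exact: segment_barycentric.
apply: faces_sub tK; apply: fintype.subset_trans (segment_supp a b s) _.
by rewrite finset.subUset sat sbt.
Qed.

Lemma set_val_realization K (a : realization R K) :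
  barycentric (set_val a) /\ supp (set_val a) \in K.
Proof. by apply/realizationP; exact: (set_ptP a). Qed.

Lemma realization_closed1 K (a : realization R K) : closed [set a].
Proof.
have cd : continuous (fun b : realization R K => \sum_v `|set_val b v - set_val a v|).
  apply: sumr_continuous => v; apply: normr_continuous.
  apply: addr_continuous; last exact: cst_continuous.
  by apply: coord_continuous; apply: val_comp_continuous; exact: id_continuous.
rewrite (_ : [set a] = (fun b : realization R K => \sum_v `|set_val b v - set_val a v|) @^-1` [set 0]).
  by apply: preimage_closed; [move=> b _; exact: cd | exact: closed_eq].
apply/seteqP; split=> [b /= ->|b /= /eqP].
  by rewrite big1 // => v _; rewrite subrr normr0.
rewrite psumr_eq0 // => /allP H; apply: set_pt_inj; apply/funext => v.
by apply/eqP; rewrite -subr_eq0 -normr_eq0; apply: H; rewrite mem_index_enum.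
Qed.

Lemma segment_continuous (X : topologicalType)
    (f g : X -> prod_topology (fun _ : V => R)) (s : X -> R) :
  continuous f -> continuous g -> continuous s ->
  continuous ((fun x => segment (f x) (g x) (s x)) : X -> prod_topology (fun _ : V => R)).
Proof.
move=> cf cg cs; apply: ptws_continuous => v; rewrite /segment.
apply: addr_continuous; apply: mulr_continuous => //.
- apply: addr_continuous; first exact: cst_continuous.
  exact: oppr_continuous.
- exact: coord_continuous.
- exact: coord_continuous.
Qed.

(** Let m be at most every positive coordinate of a. A point b at distance less than m from a is
    nonzero on the support of a, so the segment from b to a stays in the face of b, and b can be
    pulled to a along it. *)
Lemma realization_well_pointed K (a : realization R K) : well_pointed R a.
Proof.
have [[a0 a1] aK] := set_val_realization a.
pose m := \big[Num.min/1]_(v in supp (set_val a)) set_val a v.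
have m0 : 0 < m.
  apply: (big_ind (fun z : R => 0 < z)) => [|u v u0 v0|v]; first exact: ltr01.
    by rewrite lt_min u0.
  by rewrite inE lt_neqAle eq_sym a0 andbT.
have ma v : v \in supp (set_val a) -> m <= set_val a v by move=> va; exact: bigmin_le_cond.
pose d (b : realization R K) := \sum_v `|set_val b v - set_val a v| / m.
have d0 (b : realization R K) : 0 <= d b.
  by apply: sumr_ge0 => v _; rewrite mulr_ge0 // invr_ge0 ltW.
have da : d a = 0 by rewrite /d big1 // => v _; rewrite subrr normr0 mul0r.
have cval : continuous (fun b : realization R K => set_val b).
  by apply: val_comp_continuous; exact: id_continuous.
have cd : continuous d.
  apply: sumr_continuous => v; apply: mulr_continuous; last exact: cst_continuous.
  apply: normr_continuous; apply: addr_continuous; last exact: cst_continuous.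
  exact: coord_continuous.
have dsupp (b : realization R K) : d b < 1 -> supp (set_val a) \subset supp (set_val b).
  move=> db; apply/fintype.subsetP => v va; rewrite inE; apply/negP => /eqP bv.
  move: db; rewrite ltNge => /negP; apply.
  apply: (@le_trans _ _ (`|set_val b v - set_val a v| / m)).
    by rewrite bv add0r normrN ger0_norm // ler_pdivlMr // mul1r ma.
  rewrite /d (bigD1 v) //= lerDl; apply: sumr_ge0 => w _.
  by rewrite mulr_ge0 // invr_ge0 ltW.
(* In the rescaled distance [d], points up to 1/2 are pulled all the way to a and points from 1 on
   do not move. *)
pose c (p : realization R K * R) := clip (2 - 2 * d p.1) * clip p.2.
have c01 p : 0 <= c p <= 1.
  by rewrite mulr_ge0 ?clip_ge0 // mulr_ile1 ?clip_ge0 ?clip_le1.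
have DP (p : realization R K * R) : realization R K (segment (set_val p.1) (set_val a) (c p)).
  have [bb bK] := set_val_realization p.1.
  have [db|db] := ltP (d p.1) 1.
    by apply: (segment_realization _ _ bK) => //; exact: dsupp.
  have -> : c p = 0 by rewrite /c clip_eq0 ?mul0r //; lra.
  by rewrite segment0; exact: set_ptP.
exists (fun b : realization R K => Num.min 1 (2 * d b)), (fun p => set_pt (DP p)); split.
- split; last by rewrite da mulr0; apply/min_idPr; exact: ler01.
  apply: minr_continuous; first exact: cst_continuous.
  by apply: mulr_continuous => //; exact: cst_continuous.
- apply: sub_continuous; apply: segment_continuous.
  + by apply: val_comp_continuous; exact: fst_continuous.
  + exact: cst_continuous.
  + apply: mulr_continuous; last by apply: clip_continuous; exact: snd_continuous.
    apply: clip_continuous; apply: addr_continuous; first exact: cst_continuous.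
    apply: oppr_continuous; apply: mulr_continuous; first exact: cst_continuous.
    exact: (comp_continuous (@fst_continuous _ _) cd).
- by move=> b s s0; apply: set_pt_inj; rewrite set_ptE /c /= (clip_eq0 s0) mulr0 segment0.
- by move=> s; apply: set_pt_inj; rewrite set_ptE segmentxx.
- move=> b; have [b1|b1] := leP 1 (2 * d b); [by left|right].
  apply: set_pt_inj; rewrite set_ptE /c /= !clip_eq1 ?mul1r ?segment1 //; lra.
Qed.

Lemma realization_base_change K (a b : realization R K) :
  joined R a b -> pointed_equiv R a b.
Proof.
apply: well_pointed_equiv; try exact: realization_closed1; exact: realization_well_pointed.
Qed.

Lemma joined_face K (a b : realization R K) :
  supp (set_val a) :|: supp (set_val b) \in K -> joined R a b.
Proof.
move=> abK; have [ba _] := set_val_realization a; have [bb _] := set_val_realization b.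
have P s : realization R K (segment (set_val a) (set_val b) (clip s)).
  apply: (segment_realization ba bb abK); rewrite ?finset.subsetUl ?finset.subsetUr //.
  by rewrite clip_ge0 clip_le1.
exists (fun s => set_pt (P s)); split.
- apply: sub_continuous; apply: segment_continuous; try exact: cst_continuous.
  by apply: clip_continuous; exact: id_continuous.
- by move=> s s0; apply: set_pt_inj; rewrite set_ptE clip_eq0 // segment0.
- by move=> s s1; apply: set_pt_inj; rewrite set_ptE clip_eq1 // segment1.
Qed.

Definition unit_mass (v : V) : V -> R := fun w => (w == v)%:R.

Lemma unit_mass_supp v : supp (unit_mass v) = [set v]%SET.
Proof. by apply/setP => w; rewrite !inE pnatr_eq0 eqb0 negbK. Qed.

Lemma unit_mass_barycentric v : barycentric (unit_mass v).
Proof.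
split=> [w|]; first exact: ler0n.
rewrite (bigD1 v) //= big1 => [|w wv]; first by rewrite /unit_mass eqxx addr0.
by rewrite /unit_mass (negbTE wv).
Qed.

Lemma unit_mass_realization K v : [set v]%SET \in K -> realization R K (unit_mass v).
Proof.
by move=> vK; apply/realizationP; split; [exact: unit_mass_barycentric|rewrite unit_mass_supp].
Qed.

Definition vertex K v (vK : [set v]%SET \in K) : realization R K :=
  set_pt (unit_mass_realization vK).

Definition adjacent K : rel V := [rel u v | [set u; v]%SET \in K].

Lemma connect_joined K u v (uK : [set u]%SET \in K) (vK : [set v]%SET \in K) :
  connect (adjacent K) u v -> joined R (vertex uK) (vertex vK).
Proof.
case/connectP => p; elim: p u uK => [|w p IH] u uK /=.
  move=> _ vu; move: vK; rewrite vu => vK; apply: joined_face.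
  by rewrite !set_ptE !unit_mass_supp finset.setUid.
case/andP => uw pth vE.
have wK : [set w]%SET \in K by apply: faces_sub uw; apply/fintype.subsetP => z; rewrite !inE => ->; rewrite orbT.
by apply: joined_trans (IH w wK pth vE); apply: joined_face; rewrite !set_ptE !unit_mass_supp.
Qed.

(** Every point is joined to a vertex of its support, so edge paths suffice. That w is itself a
    vertex follows from the existence of any vertex, since paths end at w. *)
Lemma connected_joined K w : (forall v, [set v]%SET \in K -> connect (adjacent K) v w) ->
  forall a b : realization R K, joined R a b.
Proof.
move=> Kw.
have wK v : [set v]%SET \in K -> [set w]%SET \in K.
  move=> vK; case/connectP: (Kw v vK) => p; elim: p v vK => [|u p IH] v vK /=; first by move=> _ ->.
  case/andP => uw; apply: IH.
  by apply: faces_sub uw; apply/fintype.subsetP => z; rewrite !inE => ->; rewrite orbT.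
have H (a : realization R K) (hw : [set w]%SET \in K) : joined R a (vertex hw).
  have [ba aK] := set_val_realization a; have [v va] := barycentric_supp ba.
  have va1 : [set v]%SET \subset supp (set_val a) by rewrite finset.sub1set.
  have vK := faces_sub va1 aK.
  apply: joined_trans (connect_joined vK hw (Kw v vK)).
  apply: joined_face; rewrite !set_ptE unit_mass_supp.
  by rewrite (finset.setUidPl _).
move=> a b; have [ba aK] := set_val_realization a; have [v va] := barycentric_supp ba.
have va1 : [set v]%SET \subset supp (set_val a) by rewrite finset.sub1set.
have hw := wK v (faces_sub va1 aK).
exact: joined_trans (H a hw) (joined_sym (H b hw)).
Qed.

End realization.

Lemma homotopic_rel_set (R : realType) (X T : topologicalType) (A : set T) (x0 : X) (y0 : A)
    (f g : X -> A) (H : X * R -> T) :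
  continuous H -> (forall x s, 0 <= s <= 1 -> A (H (x, s))) ->
  (forall x, H (x, 0) = set_val (f x)) -> (forall x, H (x, 1) = set_val (g x)) ->
  (forall s, H (x0, s) = set_val y0) -> homotopic_rel R x0 y0 f g.
Proof.
move=> cH HA H0 H1 Hx.
have P (p : X * R) : A (H (p.1, clip p.2)) by apply: HA; rewrite clip_ge0 clip_le1.
apply: (homotopic_rel_unit (H := fun p => set_pt (P p))).
- apply: sub_continuous; apply: (comp_continuous _ cH); apply: pair_continuous.
    exact: fst_continuous.
  by apply: clip_continuous; exact: snd_continuous.
- by move=> x; apply: set_pt_inj; rewrite set_ptE clip_eq0.
- by move=> x; apply: set_pt_inj; rewrite set_ptE clip_eq1.
- by move=> s; apply: set_pt_inj; rewrite set_ptE Hx.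
Qed.

(** * Simplicial maps and contiguity *)

Section pushforward.
Variables (R : realType) (V W : finType) (h : V -> W).

(** The affine extension of the vertex map [h], as the image of a mass distribution. *)
Definition push (a : V -> R) : W -> R := fun w => \sum_(v | h v == w) a v.

Lemma push_barycentric a : barycentric a -> barycentric (push a).
Proof.
move=> [a0 a1]; split=> [w|]; first by apply: sumr_ge0.
by rewrite -a1 (partition_big h predT).
Qed.

Lemma push_supp a : supp (push a) \subset h @: supp a.
Proof.
apply/supp_subP => w wa; rewrite /push big1 // => v /eqP vw.
by apply: not_supp; apply: contra wa => va; apply/imsetP; exists v.
Qed.

Lemma push_continuous (X : topologicalType) (f : X -> prod_topology (fun _ : V => R)) :
  continuous f -> continuous ((fun x => push (f x)) : X -> prod_topology (fun _ : W => R)).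
Proof.
move=> cf; apply: ptws_continuous => w; apply: sumr_continuous => v.
exact: coord_continuous.
Qed.

Lemma push_unit_mass v : push (unit_mass R v) = unit_mass R (h v).
Proof.
apply/funext => w; rewrite /push /unit_mass.
have [->|wv] := eqVneq w (h v).
  by rewrite (bigD1 v) //= eqxx big1 ?addr0 // => u /andP[_ /negbTE ->].
by rewrite big1 // => u /eqP uw; case: eqP => // uv; rewrite -uw uv eqxx in wv.
Qed.

Definition simplicial_map (K : simplicial_complex V) (L : simplicial_complex W) :=
  forall s : {set V}, s \in K -> h @: s \in L.

Variables (K : simplicial_complex V) (L : simplicial_complex W).
Hypothesis hKL : simplicial_map K L.

Lemma push_realization (a : realization R K) : realization R L (push (set_val a)).
Proof.
have [ba aK] := set_val_realization a; apply/realizationP; split.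
  exact: push_barycentric.
by apply: (faces_sub (push_supp _)); exact: hKL.
Qed.

Definition realization_map (a : realization R K) : realization R L :=
  set_pt (push_realization a).

Lemma realization_map_continuous : continuous realization_map.
Proof.
apply: sub_continuous; apply: push_continuous.
by apply: val_comp_continuous; exact: id_continuous.
Qed.

End pushforward.

(** A point and its image under k o h lie in a common face, so the straight segment between them is
    a homotopy; it is constant at v because k (h v) = v. *)
Lemma contiguous_homotopic (R : realType) (V W : finType) (K : simplicial_complex V)
    (L : simplicial_complex W) (h : V -> W) (k : W -> V)
    (hKL : simplicial_map h K L) (kLK : simplicial_map k L K)
    v (vK : [set v]%SET \in K) :
  (forall s : {set V}, s \in K -> s :|: k @: (h @: s) \in K) -> k (h v) = v ->
  homotopic_rel R (vertex R vK) (vertex R vK)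
    (realization_map (R := R) kLK \o realization_map (R := R) hKL) idfun.
Proof.
move=> khK khv.
pose H (p : realization R K * R) : prod_topology (fun _ : V => R) :=
  segment (push k (push h (set_val p.1))) (set_val p.1) p.2.
apply: (homotopic_rel_set (H := H)); rewrite /H.
- have c1 : continuous (fun p : realization R K * R => set_val p.1).
    by apply: val_comp_continuous; exact: fst_continuous.
  apply: segment_continuous => //; last exact: snd_continuous.
  by apply: push_continuous; apply: push_continuous.
- move=> a s s01; have [ba aK] := set_val_realization a.
  apply: (segment_realization _ _ (khK _ aK)) => //.
  + by do 2!apply: push_barycentric.
  + apply: fintype.subset_trans (finset.subsetUr _ _).
    apply: fintype.subset_trans (push_supp _ _) _; apply: imsetS; exact: push_supp.
  + exact: finset.subsetUl.
- by move=> a; rewrite segment0.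
- by move=> a; rewrite segment1.
- by move=> s; rewrite /= !push_unit_mass khv segmentxx.
Qed.

Lemma contiguous_equiv (R : realType) (V W : finType) (K : simplicial_complex V)
    (L : simplicial_complex W) (h : V -> W) (k : W -> V) v
    (vK : [set v]%SET \in K) (hvL : [set h v]%SET \in L) :
  simplicial_map h K L -> simplicial_map k L K ->
  (forall s : {set V}, s \in K -> s :|: k @: (h @: s) \in K) ->
  (forall s : {set W}, s \in L -> s :|: h @: (k @: s) \in L) ->
  k (h v) = v ->
  pointed_equiv R (vertex R vK) (vertex R hvL).
Proof.
move=> hKL kLK khK hkL khv.
exists (realization_map hKL), (realization_map kLK); split.
- exact: realization_map_continuous.
- exact: realization_map_continuous.
- by apply: set_pt_inj; rewrite !set_ptE push_unit_mass.
- by apply: set_pt_inj; rewrite !set_ptE push_unit_mass khv.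
- split; first exact: contiguous_homotopic.
  by apply: contiguous_homotopic => //; rewrite khv.
Qed.

(** * Attaching a cone along a null-homotopic subcomplex *)

Lemma suspensionE (V : finType) (K : simplicial_complex V) (s : {set V + bool}) :
  (s \in suspension K) =
  (inl @^-1: s \in K) && ~~ ((inr false \in s) && (inr true \in s)).
Proof.
rewrite inE; congr (_ && _); rewrite inE.
apply/existsP/idP => [[u]|H].
  rewrite !inE => /andP[/orP[]/eqP-> /fintype.subsetP su]; apply/negP => /andP[s0 s1].
    by have := su true; rewrite !inE s1 => /(_ isT).
  by have := su false; rewrite !inE s0 => /(_ isT).
have [s0|s0] := boolP (inr false \in s).
  exists [set false]%SET; rewrite !inE eqxx /=; apply/fintype.subsetP => -[]; rewrite !inE //.
  by move=> s1; rewrite s0 s1 in H.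
exists [set true]%SET; rewrite !inE eqxx orbT /=; apply/fintype.subsetP => -[]; rewrite !inE //.
by rewrite (negbTE s0).
Qed.

Section cone_attachment.
Variables (R : realType) (V : finType) (A E K : simplicial_complex V) (v w : V).
Hypothesis KE : forall s : {set V}, (s \in K) = (s \in A) || (s :\ v \in E).
Hypothesis wEA : forall s : {set V}, s \in E -> w |: s \in A.
Hypothesis vA : [set v]%SET \notin A.

Local Notation S := (suspension E).
Local Notation q := (inr false : V + bool).
Local Notation p := (inr true : V + bool).
Implicit Types (a b y : V -> R) (z : V + bool -> R) (s : R).

(* Weights in terms of the coordinate s at v. Truncating the denominators keeps *)
(* them continuous at s = 1.                                                    *)
Let m1 s : R := Num.min 1 (2 * s).
Let c1 s : R := Num.max 0 (1 - 2 * s) / Num.max (1 - s) 2^-1.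
Let mq s : R := clip (3 - 4 * s).
Let mp s : R := Num.max 0 (4 * s - 3).
Let cr s : R := (Num.max (1 - s) 4^-1)^-1.
Let c2 s : R := (1 - mq s) * cr s.

Let m1_ge0 s : 0 <= s -> 0 <= m1 s.
Proof. by move=> s0; rewrite le_min ler01 mulr_ge0. Qed.
Let m1_eq1 s : 2^-1 <= s -> m1 s = 1.
Proof. by move=> s2; apply/min_idPl; lra. Qed.
Let c1_ge0 s : 0 <= c1 s.
Proof.
by apply: divr_ge0; rewrite le_max ?lexx // invr_ge0 ler0n orbT.
Qed.
Let c1_eq0 s : 2^-1 <= s -> c1 s = 0.
Proof. by move=> s2; rewrite /c1 (max_idPl _) ?mul0r //; lra. Qed.
Let c1m1 s : 0 <= s <= 1 -> c1 s * (1 - s) + m1 s = 1.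
Proof.
move=> /andP[s0 s1]; have [s2|s2] := leP 2^-1 s.
  by rewrite c1_eq0 // m1_eq1 // mul0r add0r.
rewrite /c1 /m1 (max_idPr _); last by lra.
rewrite (max_idPl _); last by lra.
rewrite (min_idPr _); last by lra.
by rewrite divfK; [lra | rewrite gt_eqF //; lra].
Qed.
Let c1_0 : c1 0 = 1.
Proof. by have := @c1m1 0; rewrite /m1 mulr0 (min_idPr _) // subr0 mulr1 addr0; apply; rewrite lexx ler01. Qed.
Let m1_0 : m1 0 = 0.
Proof. by rewrite /m1 mulr0; apply/min_idPr. Qed.

Let mq_ge0 s : 0 <= mq s. Proof. exact: clip_ge0. Qed.
Let mq_le1 s : mq s <= 1. Proof. exact: clip_le1. Qed.
Let mq_eq1 s : s <= 2^-1 -> mq s = 1. Proof. by move=> s2; apply: clip_eq1; lra. Qed.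
Let mq_eq0 s : 3 / 4 <= s -> mq s = 0. Proof. by move=> s2; apply: clip_eq0; lra. Qed.
Let mp_ge0 s : 0 <= mp s. Proof. by rewrite le_max lexx. Qed.
Let mp_eq0 s : s <= 3 / 4 -> mp s = 0. Proof. by move=> s2; apply/max_idPl; lra. Qed.
Let cr_gt0 s : 0 < cr s.
Proof. by rewrite invr_gt0 lt_max; apply/orP; right; lra. Qed.
Let crmp s : 0 <= s <= 1 -> cr s * (1 - s) + mp s = 1.
Proof.
move=> /andP[s0 s1]; have [s2|s2] := leP s (3 / 4).
  rewrite mp_eq0 // addr0 /cr (max_idPl _); last by lra.
  by rewrite mulVf // gt_eqF //; lra.
rewrite /cr /mp (max_idPr _); last by lra.
by rewrite (max_idPr _) ?invrK; lra.
Qed.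
Let cr_0 : cr 0 = 1.
Proof. by have := @crmp 0; rewrite mp_eq0 ?subr0 ?mulr1 ?addr0; [apply; rewrite lexx ler01|lra]. Qed.
Let c2_ge0 s : 0 <= c2 s.
Proof. by apply: mulr_ge0; [have := mq_le1 s; lra | exact: ltW]. Qed.
Let c2_eq0 s : s <= 2^-1 -> c2 s = 0.
Proof. by move=> s2; rewrite /c2 mq_eq1 // subrr mul0r. Qed.
Let c2mqmp s : 0 <= s <= 1 -> c2 s * (1 - s) + mq s + mp s = 1.
Proof.
move=> s01; have /eqP := crmp s01; have [s2|s2] := leP s (3 / 4).
  by rewrite mp_eq0 // !addr0 /c2 -mulrA => /eqP ->; lra.
by move=> /eqP H; rewrite /c2 mq_eq0 ?subr0 ?mul1r ?addr0 //; lra.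
Qed.

Section scalars_continuous.
Variables (X : topologicalType) (f : X -> R).
Hypothesis cf : continuous f.
Let c_aff (k l : R) : continuous (fun x => k + l * f x).
Proof.
by apply: addr_continuous; [|apply: mulr_continuous => //]; exact: cst_continuous.
Qed.
Let c_sub : continuous (fun x => 1 - f x).
Proof. by apply: addr_continuous; [exact: cst_continuous|exact: oppr_continuous]. Qed.

Let m1_continuous : continuous (fun x => m1 (f x)).
Proof.
apply: minr_continuous; first exact: cst_continuous.
by apply: mulr_continuous => //; exact: cst_continuous.
Qed.
Let c1_continuous : continuous (fun x => c1 (f x)).
Proof.
apply: mulr_continuous.
  apply: maxr_continuous; first exact: cst_continuous.
  apply: addr_continuous; first exact: cst_continuous.
  by apply: oppr_continuous; apply: mulr_continuous => //; exact: cst_continuous.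
apply: invr_continuous.
  by move=> x; rewrite gt_eqF // lt_max; apply/orP; right; lra.
by apply: maxr_continuous => //; exact: cst_continuous.
Qed.
Let mq_continuous : continuous (fun x => mq (f x)).
Proof.
apply: clip_continuous; apply: addr_continuous; first exact: cst_continuous.
by apply: oppr_continuous; apply: mulr_continuous => //; exact: cst_continuous.
Qed.
Let mp_continuous : continuous (fun x => mp (f x)).
Proof.
apply: maxr_continuous; first exact: cst_continuous.
apply: addr_continuous; last exact: cst_continuous.
by apply: mulr_continuous => //; exact: cst_continuous.
Qed.
Let cr_continuous : continuous (fun x => cr (f x)).
Proof.
apply: invr_continuous.
  by move=> x; rewrite gt_eqF // lt_max; apply/orP; right; lra.
by apply: maxr_continuous => //; exact: cst_continuous.
Qed.
Let c2_continuous : continuous (fun x => c2 (f x)).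
Proof.
apply: mulr_continuous => //; apply: addr_continuous; first exact: cst_continuous.
exact: oppr_continuous.
Qed.

Lemma attachment_scalars_continuous :
  [/\ continuous (fun x => m1 (f x)), continuous (fun x => c1 (f x)),
      continuous (fun x => mq (f x)), continuous (fun x => mp (f x)) &
      continuous (fun x => cr (f x)) /\ continuous (fun x => c2 (f x))].
Proof. by []. Qed.
End scalars_continuous.

(** The E-part of a point of the cone v*E, left unnormalised: its mass is 1 - a v. *)
Let base a (u : V) : R := if u == v then 0 else a u.

(* The pinch: the part v < 1/2 of the cone is stretched over E u w*E inside A, *)
(* the part v > 1/2 over the suspension.                                      *)
Let theta1 a (u : V) : R := c1 (a v) * base a u + m1 (a v) * unit_mass R w u.
Let theta2 a (x : V + bool) : R :=
  match x with
  | inl u => c2 (a v) * base a u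
  | inr false => mq (a v)
  | inr true => mp (a v)
  end.

(** The inverse of the pinch. On the wedge one of y and [push fold z] is the unit mass at w, which
    the subtraction in [psi] removes; so one affine formula is the inclusion on A and the fold on
    the suspension. *)
Let fold (x : V + bool) : V := match x with inl u => u | inr false => w | inr true => v end.
Let psi y z (u : V) : R := y u + push fold z u - unit_mass R w u.

(** Reparametrises the coordinate at v: values up to 3/4 become 0 and [3/4, 1] is stretched over
    [0, 1]. [rho'] does the same at the pole p. They are intermediate stages between the composites
    of [theta] and [psi] and the identity. *)
Let rho a (u : V) : R := cr (a v) * base a u + mp (a v) * unit_mass R v u.
Let rho' z (x : V + bool) : R :=
  if x == p then mp (z p) else cr (z p) * z x.

Let pushE z u : push fold z u = z (inl u) + z q * unit_mass R w u + z p * unit_mass R v u.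
Proof.
rewrite /push big_mkcond /= big_sumType /= big_bool /= -big_mkcond /=.
rewrite (big_pred1 u) //= -addrA; congr (_ + _).
rewrite /unit_mass !(eq_sym u) addrC.
by case: (w == u); case: (v == u); rewrite ?mulr1 ?mulr0.
Qed.

Let base_supp a : supp (base a) = (supp a :\ v)%SET.
Proof. by apply/setP => u; rewrite !inE /base; case: (u == v); rewrite ?eqxx. Qed.

Let base_sum a : barycentric a -> \sum_u base a u = 1 - a v.
Proof.
move=> [_ <-]; rewrite (bigD1 v) //= [in RHS](bigD1 v) //= /base eqxx add0r.
rewrite addrC addrK; apply: eq_bigr => u /negbTE -> //.
Qed.

Let base_ge0 a u : barycentric a -> 0 <= base a u.
Proof. by move=> [a0 _]; rewrite /base; case: ifP. Qed.

Let base_id a : a v = 0 -> base a = a.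
Proof. by move=> av; apply/funext => u; rewrite /base; case: eqP => // ->. Qed.

Let unit_mass_sum (T : finType) (u : T) : \sum_x unit_mass R u x = 1.
Proof. by have [] := unit_mass_barycentric R u. Qed.

Let unit_mass_ge0 (T : finType) (u x : T) : 0 <= unit_mass R u x.
Proof. exact: ler0n. Qed.

Let coord01 (T : finType) (a : T -> R) u : barycentric a -> 0 <= a u <= 1.
Proof. by move=> ba; rewrite ba.1 barycentric_le1. Qed.

(** A face of K avoiding v lies in A even if it comes from the cone, since E lies in w*E and hence
    in A. A face through v comes from the cone, v being no vertex of A. *)
Let in_K a : barycentric a -> supp a \in K ->
  (a v = 0 /\ supp a \in A) \/ (0 < a v /\ (supp a :\ v)%SET \in E).
Proof.
move=> ba aK; have [av|av] := eqVneq (a v) 0.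
  left; split=> //; move: aK; rewrite KE => /orP[//|aE].
  apply: faces_sub (wEA aE).
  apply: fintype.subset_trans (finset.subsetUr _ _).
  by apply/fintype.subsetP => u ua; rewrite !inE in ua *; rewrite ua andbT; apply: contra ua => /eqP ->; rewrite av.
right; split; first by rewrite lt_neqAle eq_sym av ba.1.
move: aK; rewrite KE => /orP[aA|//].
by case/negP: vA; apply: faces_sub aA; rewrite finset.sub1set inE.
Qed.

Let A_K (s : {set V}) : s \in A -> s \in K.
Proof. by rewrite KE => ->. Qed.

Let vE_K (s : {set V}) : s \in E -> v |: s \in K.
Proof.
move=> sE; rewrite KE; apply/orP; right; apply: faces_sub sE.
by apply/fintype.subsetP => u; rewrite !inE => /andP[/negbTE ->].
Qed.

Let theta1_barycentric a : barycentric a -> barycentric (theta1 a).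
Proof.
move=> ba; have /andP[s0 s1] := coord01 v ba; split=> [u|].
  by apply: addr_ge0; apply: mulr_ge0 => //; [exact: base_ge0|exact: m1_ge0].
rewrite /theta1 big_split /= -!mulr_sumr base_sum // unit_mass_sum mulr1.
by rewrite c1m1 // s0.
Qed.

Let theta1_supp a : supp (theta1 a) \subset (w |: (supp a :\ v))%SET.
Proof.
rewrite -base_supp; apply/supp_subP => u; rewrite !inE negb_or negbK => /andP[/negbTE uw /eqP u0].
by rewrite /theta1 u0 mulr0 add0r /unit_mass uw mulr0.
Qed.

Let theta1_id a : a v = 0 -> theta1 a = a.
Proof.
move=> av; apply/funext => u; rewrite /theta1 av c1_0 m1_0 mul1r mul0r addr0.
by rewrite base_id.
Qed.

Let theta1_w a : 2^-1 <= a v -> theta1 a = unit_mass R w.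
Proof.
by move=> av; apply/funext => u; rewrite /theta1 c1_eq0 // m1_eq1 // mul0r mul1r add0r.
Qed.

Let theta2_barycentric a : barycentric a -> barycentric (theta2 a).
Proof.
move=> ba; have s01 := coord01 v ba; split=> [[u|[]]|] /=.
- by apply: mulr_ge0 => //; exact: base_ge0.
- exact: mp_ge0.
- exact: mq_ge0.
rewrite big_sumType /= big_bool /= -mulr_sumr base_sum // [_ + mq _]addrC addrA.
exact: c2mqmp.
Qed.

Let theta2_q a : a v <= 2^-1 -> theta2 a = unit_mass R q.
Proof.
move=> av; apply/funext => -[u|[]]; rewrite /unit_mass /=.
- by rewrite c2_eq0 // mul0r.
- by rewrite mp_eq0 //; lra.
- by rewrite mq_eq1.
Qed.

Let cone_face (r : V + bool) (t : {set V}) : t \in E -> (forall u, r != inl u) ->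
  (r |: inl @: t)%SET \in S.
Proof.
move=> tE ru; rewrite suspensionE; apply/andP; split.
  apply: faces_sub tE; apply/fintype.subsetP => u; rewrite !inE eq_sym (negbTE (ru u)) /=.
  by case/imsetP => x xt [->].
apply/negP; rewrite !inE => /andP[/orP[/eqP <-|/imsetP[]//] /orP[//|/imsetP[]//]].
Qed.

Let theta2_supp a : 3 / 4 <= a v -> supp (theta2 a) \subset (p |: inl @: (supp a :\ v))%SET.
Proof.
move=> av; apply/supp_subP => -[u|[]]; rewrite !inE //= => H.
  suff /not_supp -> : u \notin supp (base a) by rewrite mulr0.
  by rewrite base_supp; apply: contra H; apply: imset_f.
by rewrite mq_eq0.
Qed.

Let theta2_supp' a : a v <= 3 / 4 -> supp (theta2 a) \subset (q |: inl @: (supp a :\ v))%SET.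
Proof.
move=> av; apply/supp_subP => -[u|[]]; rewrite !inE //= => H.
  suff /not_supp -> : u \notin supp (base a) by rewrite mulr0.
  by rewrite base_supp; apply: contra H; apply: imset_f.
by rewrite mp_eq0.
Qed.

Hypotheses (qS : [set q]%SET \in S) (wA : [set w]%SET \in A).

Let theta1_realization (a : realization R K) : realization R A (theta1 (set_val a)).
Proof.
have [ba aK] := set_val_realization a; apply/realizationP; split; first exact: theta1_barycentric.
case: (in_K ba aK) => [[av aA]|[av aE]]; first by rewrite theta1_id.
exact: faces_sub (theta1_supp _) (wEA aE).
Qed.

Let theta2_realization (a : realization R K) : realization R S (theta2 (set_val a)).
Proof.
have [ba aK] := set_val_realization a; apply/realizationP; split; first exact: theta2_barycentric.
have [av|av] := leP (set_val a v) 2^-1; first by rewrite theta2_q // unit_mass_supp.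
case: (in_K ba aK) => [[a0 _]|[_ aE]]; first by move: av; rewrite a0; lra.
have [av'|/ltW av'] := leP (set_val a v) (3 / 4).
  by apply: faces_sub (theta2_supp' av') _; exact: cone_face.
by apply: faces_sub (theta2_supp av') _; exact: cone_face.
Qed.

Local Notation vw := (vertex R wA).
Local Notation vq := (vertex R qS).

Let theta1_pt (a : realization R K) : realization R A := set_pt (theta1_realization a).
Let theta2_pt (a : realization R K) : realization R S := set_pt (theta2_realization a).

(** Up to v = 1/2 the second coordinate is constantly q, and from there on the first is constantly
    w. *)
Let theta_wedge (a : realization R K) : wedge2 vw vq (theta1_pt a, theta2_pt a).
Proof.
have [av|av] := leP (set_val a v) 2^-1.
  by right; apply: set_pt_inj; rewrite !set_ptE theta2_q.
by left; apply: set_pt_inj; rewrite !set_ptE theta1_w // ltW.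
Qed.

Let theta (a : realization R K) : wedge2 vw vq := set_pt (theta_wedge a).

Let base_continuous (X : topologicalType) (f : X -> prod_topology (fun _ : V => R)) u :
  continuous f -> continuous (fun x => base (f x) u).
Proof.
move=> cf; rewrite /base; case: (u == v); first exact: cst_continuous.
exact: coord_continuous.
Qed.

Let theta1_continuous (X : topologicalType) (f : X -> prod_topology (fun _ : V => R)) :
  continuous f -> continuous ((fun x => theta1 (f x)) : X -> prod_topology (fun _ : V => R)).
Proof.
move=> cf; apply: ptws_continuous => u.
have cfv : continuous (fun x => f x v) by exact: coord_continuous.
have [k1 k2 _ _ _] := attachment_scalars_continuous cfv.
apply: addr_continuous; apply: mulr_continuous => //; last exact: cst_continuous.
exact: base_continuous.
Qed.

Let theta2_continuous (X : topologicalType) (f : X -> prod_topology (fun _ : V => R)) :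
  continuous f ->
  continuous ((fun x => theta2 (f x)) : X -> prod_topology (fun _ : V + bool => R)).
Proof.
move=> cf; apply: ptws_continuous => u.
have cfv : continuous (fun x => f x v) by exact: coord_continuous.
have [_ _ k1 k2 [_ k3]] := attachment_scalars_continuous cfv.
case: u => [u|[]] //=; apply: mulr_continuous => //; exact: base_continuous.
Qed.

Let val_continuous (L : finType) (M : simplicial_complex L) :
  continuous (fun a : realization R M => set_val a).
Proof. by apply: val_comp_continuous; exact: id_continuous. Qed.

Let theta_continuous : continuous theta.
Proof.
apply: sub_continuous; apply: pair_continuous; apply: sub_continuous.
- exact: (theta1_continuous (@val_continuous _ _)).
- exact: (theta2_continuous (@val_continuous _ _)).
Qed.

(** A face of the suspension has at most one pole: with p it folds into v*E, otherwise into w*E,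
    which lies in A. *)
Let fold_simplicial : simplicial_map fold S K.
Proof.
move=> s; rewrite suspensionE => /andP[sE spq].
have [ps|ps] := boolP (p \in s).
  apply: faces_sub (vE_K sE); apply/fintype.subsetP => u /imsetP[[x|[]] xs ->] /=; rewrite !inE ?eqxx //.
    by rewrite xs orbT.
  by rewrite xs ps in spq.
apply: A_K; apply: faces_sub (wEA sE); apply/fintype.subsetP => u /imsetP[[x|[]] xs ->] /=; rewrite !inE ?eqxx //.
  by rewrite xs orbT.
by rewrite xs in ps.
Qed.

Let psi_realization (y : wedge2 vw vq) :
  realization R K (psi (set_val (set_val y).1) (set_val (set_val y).2)).
Proof.
have [ba aA] := set_val_realization (set_val y).1.
case: (set_ptP y) => ->.
  rewrite (_ : psi _ _ = push fold (set_val (set_val y).2)).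
    exact: (push_realization fold_simplicial).
  by apply/funext => u; rewrite /psi set_ptE addrAC subrr add0r.
rewrite (_ : psi _ _ = set_val (set_val y).1).
  by apply/realizationP; split=> //; exact: A_K.
by apply/funext => u; rewrite /psi set_ptE push_unit_mass addrK.
Qed.

Let psi_pt (y : wedge2 vw vq) : realization R K := set_pt (psi_realization y).

Let wedge_val1_continuous : continuous (fun y : wedge2 vw vq => set_val (set_val y).1).
Proof.
apply: val_comp_continuous; apply: fst_comp_continuous; apply: val_comp_continuous.
exact: id_continuous.
Qed.

Let wedge_val2_continuous : continuous (fun y : wedge2 vw vq => set_val (set_val y).2).
Proof.
apply: val_comp_continuous; apply: snd_comp_continuous; apply: val_comp_continuous.
exact: id_continuous.
Qed.

Let psi_continuous : continuous psi_pt.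
Proof.
apply: sub_continuous; apply: ptws_continuous => u.
apply: addr_continuous; last exact: cst_continuous.
apply: addr_continuous; first exact: coord_continuous wedge_val1_continuous.
apply: (@coord_continuous _ _ _ (fun y : wedge2 vw vq => push fold (set_val (set_val y).2))).
exact: push_continuous.
Qed.

Let rho_barycentric a : barycentric a -> barycentric (rho a).
Proof.
move=> ba; have s01 := coord01 v ba; split=> [u|].
  by apply: addr_ge0; apply: mulr_ge0 => //; [exact: ltW|exact: base_ge0].
by rewrite /rho big_split /= -!mulr_sumr base_sum // unit_mass_sum mulr1 crmp.
Qed.

Let rho_id a : a v = 0 -> rho a = a.
Proof.
move=> av; apply/funext => u; rewrite /rho av cr_0 mul1r mp_eq0; last by lra.
by rewrite mul0r addr0 base_id.
Qed.

Let rho_supp a : supp (rho a) \subset supp a.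
Proof.
apply/supp_subP => u ua; have au := not_supp ua.
have u0 : base a u = 0 by rewrite /base au if_same.
rewrite /rho u0 mulr0 add0r /unit_mass; case: eqP => [uv|]; last by rewrite mulr0.
by rewrite -uv au mp_eq0 ?mul0r //; lra.
Qed.

Let psi_theta a u : psi (theta1 a) (theta2 a) u =
  (c1 (a v) + c2 (a v)) * base a u + (m1 (a v) + mq (a v) - 1) * unit_mass R w u
    + mp (a v) * unit_mass R v u.
Proof. by rewrite /psi pushE /theta1 /=; ring. Qed.

Let rho_realization (a : realization R K) : realization R K (rho (set_val a)).
Proof.
have [ba aK] := set_val_realization a; apply/realizationP; split; first exact: rho_barycentric.
exact: faces_sub (rho_supp _) aK.
Qed.

Let rho_pt (a : realization R K) : realization R K := set_pt (rho_realization a).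

Variables (a0 : realization R A).

Let a0_v : set_val a0 v = 0.
Proof.
have [b0 a0A] := set_val_realization a0; apply: not_supp; apply/negP => vs.
by case/negP: vA; apply: faces_sub a0A; rewrite finset.sub1set.
Qed.

Let a0_realization : realization R K (set_val a0).
Proof.
have [b0 a0A] := set_val_realization a0; apply/realizationP; split=> //; exact: A_K.
Qed.

Let a0K : realization R K := set_pt a0_realization.
Let a0W : wedge2 vw vq := set_pt (or_intror erefl : wedge2 vw vq (a0, vq)).

Let theta_a0 : theta a0K = a0W.
Proof.
apply: set_pt_inj; rewrite /theta /a0W !set_ptE; congr (_, _); apply: set_pt_inj.
- exact: (theta1_id a0_v).
- have a0_v2 : set_val a0 v <= 2^-1 by rewrite a0_v; lra.
  exact: (theta2_q a0_v2).
Qed.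

Let psi_a0 : psi_pt a0W = a0K.
Proof.
apply: set_pt_inj; apply/funext => u.
transitivity (psi (set_val a0) (unit_mass R q) u); first by [].
by rewrite /psi push_unit_mass addrK.
Qed.

(** Along a segment from a point of E to v, the composite goes to w, back to the point of E, and
    then up to v, whereas [rho] waits in E during the detour. The detour takes place in w*E, inside
    A, and is removed linearly; [rho] is then linearly homotopic to the identity since it does not
    enlarge supports. *)
Let psi_theta_homotopic : homotopic_rel R a0K a0K (psi_pt \o theta) idfun.
Proof.
have pt_bary (a : realization R K) : barycentric (psi (theta1 (set_val a)) (theta2 (set_val a))).
  by have [] := set_val_realization (psi_pt (theta a)).
apply: (@homotopic_rel_trans R _ _ _ _ _ rho_pt).
- pose H (x : realization R K * R) : prod_topology (fun _ : V => R) :=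
    segment (psi (theta1 (set_val x.1)) (theta2 (set_val x.1))) (rho (set_val x.1)) x.2.
  apply: (homotopic_rel_set (H := H)); rewrite /H.
  + apply: segment_continuous; last exact: snd_continuous.
      apply: (@val_comp_continuous _ _ _ (fun x : realization R K * R => psi_pt (theta x.1))).
      exact: (comp_continuous (@fst_continuous _ _)
        (comp_continuous theta_continuous psi_continuous)).
    have c1' : continuous (fun x : realization R K * R => set_val x.1).
      exact: (comp_continuous (@fst_continuous _ _) (@val_continuous _ _)).
    apply: ptws_continuous => u.
    have cfv : continuous (fun x : realization R K * R => set_val x.1 v) by exact: (coord_continuous (v := v) c1').
    have [_ _ _ k2 [k3 _]] := attachment_scalars_continuous cfv.
    apply: addr_continuous; apply: mulr_continuous => //; last exact: cst_continuous.
    exact: (base_continuous (u := u) c1').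
  + move=> a s s01 /=; have [ba aK] := set_val_realization a.
    case: (in_K ba aK) => [[av aA]|[av aE]].
      rewrite rho_id // (_ : psi _ _ = set_val a) ?segmentxx; first exact/realizationP.
      apply/funext => u; rewrite psi_theta av c1_0 m1_0 c2_eq0 ?mq_eq1 ?mp_eq0 //; try lra.
      by rewrite addr0 mul1r add0r subrr !mul0r !addr0 base_id.
    (* Up to 3/4 both ends live on w and the E-part of the support, a face of A. Beyond 3/4 the
       weight m1 + mq - 1 of w vanishes and both stay in the support of a. *)
    have [av'|av'] := leP (set_val a v) (3 / 4).
      apply: (segment_realization _ _ (A_K (wEA aE))) => //; first exact: rho_barycentric.
        rewrite -base_supp; apply/supp_subP => u.
        rewrite !inE negb_or negbK => /andP[/negbTE uw /eqP u0].
        by rewrite psi_theta u0 mp_eq0 // /unit_mass uw !mulr0 mul0r !addr0.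
      rewrite -base_supp; apply/supp_subP => u.
      rewrite !inE negb_or negbK => /andP[/negbTE uw /eqP u0].
      by rewrite /rho u0 mp_eq0 // mulr0 mul0r addr0.
    apply: (segment_realization _ _ aK) => //; first exact: rho_barycentric.
    apply/supp_subP => u ua; have au := not_supp ua.
    have u0 : base (set_val a) u = 0 by rewrite /base au if_same.
    rewrite psi_theta m1_eq1 ?mq_eq0; try lra.
    rewrite u0 addr0 subrr mulr0 mul0r !add0r /unit_mass; case: eqP => [uv|]; last by rewrite mulr0.
    by rewrite -uv au mp_eq0 ?mul0r //; lra.
  + by move=> a /=; rewrite segment0.
  + by move=> a /=; rewrite segment1.
  + move=> s /=; have a0Kv : set_val a0K v = 0 := a0_v.
    rewrite rho_id // theta1_id // theta2_q; last by rewrite a0Kv; lra.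
    rewrite (_ : psi _ _ = set_val a0K) ?segmentxx //.
    by apply/funext => u; rewrite /psi push_unit_mass addrK.
- pose H (x : realization R K * R) : prod_topology (fun _ : V => R) :=
    segment (rho (set_val x.1)) (set_val x.1) x.2.
  have c1' : continuous (fun x : realization R K * R => set_val x.1).
    exact: (comp_continuous (@fst_continuous _ _) (@val_continuous _ _)).
  apply: (homotopic_rel_set (H := H)); rewrite /H.
  + apply: segment_continuous => //; last exact: snd_continuous.
    apply: ptws_continuous => u.
    have cfv : continuous (fun x : realization R K * R => set_val x.1 v) by exact: (coord_continuous (v := v) c1').
    have [_ _ _ k2 [k3 _]] := attachment_scalars_continuous cfv.
    apply: addr_continuous; apply: mulr_continuous => //; last exact: cst_continuous.
    exact: (base_continuous (u := u) c1').
  + move=> a s s01 /=; have [ba aK] := set_val_realization a.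
    by apply: (segment_realization _ _ aK) => //; exact: rho_barycentric.
  + by move=> a /=; rewrite segment0.
  + by move=> a /=; rewrite segment1.
  + by move=> s /=; rewrite rho_id // segmentxx.
Qed.

Let wv : w != v.
Proof. by apply: contra vA => /eqP <-. Qed.

Let E_v (t : {set V}) : t \in E -> v \notin t.
Proof.
move=> tE; apply: contra vA => vt; apply: faces_sub (wEA tE).
by rewrite finset.sub1set !inE vt orbT.
Qed.

Let S_E (t : {set V + bool}) : t \in S -> (inl @^-1: t)%SET \in E.
Proof. by rewrite suspensionE => /andP[]. Qed.

Let S_qp z : supp z \in S -> z q = 0 \/ z p = 0.
Proof.
rewrite suspensionE => /andP[_]; rewrite negb_and => /orP[|] /not_supp; by [left|right].
Qed.

Let S_v z : supp z \in S -> z (inl v) = 0.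
Proof. by move=> /S_E/E_v; rewrite inE => /not_supp. Qed.

Let push_v z : supp z \in S -> push fold z v = z p.
Proof.
move=> zS; rewrite pushE S_v // /unit_mass eqxx eq_sym (negbTE wv).
by rewrite mulr0 mulr1 addr0 add0r.
Qed.

Let push_base z : supp z \in S ->
  (supp (push fold z) :\ v \subset w |: (inl @^-1: supp z))%SET.
Proof.
move=> zS; apply/fintype.subsetP => u; rewrite !inE => /andP[uv].
apply: contraR; rewrite negb_or negbK => /andP[uw /eqP u0].
by rewrite pushE u0 /unit_mass (negbTE uv) (negbTE uw) !mulr0 !addr0.
Qed.

Let psi_q (y : wedge2 vw vq) : (set_val y).2 = vq ->
  psi (set_val (set_val y).1) (set_val (set_val y).2) = set_val (set_val y).1.
Proof. by move=> ->; apply/funext => u; rewrite /psi set_ptE push_unit_mass addrK. Qed.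

Let psi_w (y : wedge2 vw vq) : (set_val y).1 = vw ->
  psi (set_val (set_val y).1) (set_val (set_val y).2) = push fold (set_val (set_val y).2).
Proof. by move=> ->; apply/funext => u; rewrite /psi set_ptE addrAC subrr add0r. Qed.

Let A_v (a : realization R A) : set_val a v = 0.
Proof.
have [_ aA] := set_val_realization a; apply: not_supp; apply: contra vA => va.
by apply: faces_sub aA; rewrite finset.sub1set.
Qed.

Let psi_pt_v (y : wedge2 vw vq) : (set_val y).2 = vq -> set_val (psi_pt y) v = 0.
Proof. by move=> y2; rewrite /psi_pt set_ptE psi_q // A_v. Qed.

Let rho'_barycentric z : barycentric z -> barycentric (rho' z).
Proof.
move=> bz; have /andP[p0 p1] := coord01 p bz; split=> [x|].
  by rewrite /rho'; case: ifP => _ //; apply: mulr_ge0; [exact: ltW|exact: bz.1].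
rewrite -[RHS](@crmp (z p)); last by rewrite p0.
rewrite big_sumType big_bool /rho' /= -mulr_sumr [mp _ + _]addrC addrA -mulrDr.
congr (_ * _ + _); rewrite -bz.2 big_sumType big_bool /=.
by rewrite [z p + _]addrC addrA addrK.
Qed.

Let rho'_supp z : supp (rho' z) \subset supp z.
Proof.
apply/supp_subP => x /not_supp zx; rewrite /rho'; case: eqP => [<-|_].
  by rewrite zx mp_eq0 //; lra.
by rewrite zx mulr0.
Qed.

Let rho'_q : rho' (unit_mass R q) = unit_mass R q.
Proof.
apply/funext => x; rewrite /rho' {1 2}/unit_mass /=.
by case: eqP => [->|_]; [rewrite mp_eq0 //; lra | rewrite cr_0 mul1r].
Qed.

Let rho'_continuous (X : topologicalType) (f : X -> prod_topology (fun _ : V + bool => R)) :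
  continuous f ->
  continuous ((fun x => rho' (f x)) : X -> prod_topology (fun _ : V + bool => R)).
Proof.
move=> cf; apply: ptws_continuous => x.
have cfp : continuous (fun x => f x p) by exact: coord_continuous.
have [_ _ _ k1 [k2 _]] := attachment_scalars_continuous cfp.
rewrite /rho'; case: (x == p) => //; apply: mulr_continuous => //.
exact: coord_continuous.
Qed.

Let slide1_realization (x : wedge2 vw vq * R) :
  realization R A (segment (theta1 (set_val (psi_pt x.1))) (set_val (set_val x.1).1) (clip x.2)).
Proof.
have s01 : 0 <= clip x.2 <= 1 by rewrite clip_ge0 clip_le1.
have [bb bK] := set_val_realization (psi_pt x.1).
have [by_ yA] := set_val_realization (set_val x.1).1.
have [bz zS] := set_val_realization (set_val x.1).2.
case: (set_ptP x.1) => [y1|y2].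
  apply: (segment_realization _ _ (wEA (S_E zS))) => //; first exact: theta1_barycentric.
    apply: fintype.subset_trans (theta1_supp _) _.
    rewrite finset.subUset finset.subsetUl /= /psi_pt set_ptE psi_w //.
    exact: push_base.
  by rewrite y1 set_ptE unit_mass_supp finset.subsetUl.
rewrite /psi_pt set_ptE psi_q // theta1_id; last exact: A_v.
rewrite segmentxx; exact: set_ptP.
Qed.

(** On the suspension branch the first coordinate moves only while the second one rests at q: above
    v = 1/2 [theta1] is already w, its final value. *)
Let slide1_wedge (x : wedge2 vw vq * R) :
  wedge2 vw vq (set_pt (slide1_realization x), theta2_pt (psi_pt x.1)).
Proof.
have [sb|sb] := leP (set_val (psi_pt x.1) v) 2^-1.
  by right; apply: set_pt_inj; exact: (theta2_q sb).
case: (set_ptP x.1) => [y1|y2].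
  have seg_w : segment (theta1 (set_val (psi_pt x.1))) (set_val (set_val x.1).1) (clip x.2)
      = unit_mass R w.
    by rewrite (theta1_w (ltW sb)) y1; exact: segmentxx.
  by left; apply: set_pt_inj; exact: seg_w.
by move: sb; rewrite psi_pt_v //; lra.
Qed.

Let slide2_realization (x : wedge2 vw vq * R) :
  realization R S (segment (theta2 (set_val (psi_pt x.1))) (rho' (set_val (set_val x.1).2)) (clip x.2)).
Proof.
have s01 : 0 <= clip x.2 <= 1 by rewrite clip_ge0 clip_le1.
have [bb bK] := set_val_realization (psi_pt x.1).
have [bz zS] := set_val_realization (set_val x.1).2.
case: (set_ptP x.1) => [y1|y2]; last first.
  rewrite y2 theta2_q; last by rewrite psi_pt_v //; lra.
  by rewrite rho'_q segmentxx; exact: unit_mass_realization.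
move: (set_val (psi_pt x.1)) (psi_w y1 : set_val (psi_pt x.1) = _) bb => b bE bb.
set z := set_val _ in bz zS bE *.
have bv : b v = z p by rewrite bE push_v.
(* Off v, folding adds mass only at w, coming from q, and a face that contains p does not contain
   q. *)
have b_z u : z p != 0 -> base b u = z (inl u).
  move=> zp; rewrite /base; have [->|uv] := eqVneq u v; first by rewrite S_v.
  have [zq|/eqP] := S_qp zS; last by rewrite (negbTE zp).
  by rewrite bE pushE zq /unit_mass (negbTE uv) mul0r mulr0 !addr0.
(* [theta2] and [rho'] change poles at the same height 3/4, so at each point both ends lie in one
   cone, with apex r, over the E-part of z. *)
pose r := if z p <= 3 / 4 then q else p.
have rF : (r |: inl @: (inl @^-1: supp z))%SET \in S.
  by apply: cone_face; [exact: S_E | rewrite /r; case: ifP].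
apply: (segment_realization _ _ rF) => //.
- exact: theta2_barycentric.
- exact: rho'_barycentric.
- have [zp2|zp2] := leP (z p) 2^-1.
    rewrite theta2_q ?bv // unit_mass_supp finset.sub1set !inE /r ifT ?eqxx //; lra.
  have sE : (supp b :\ v \subset inl @^-1: supp z)%SET.
    rewrite -base_supp; apply/supp_subP => u; rewrite inE => /not_supp zu.
    by rewrite b_z // gt_eqF //; lra.
  have sI : (r |: inl @: (supp b :\ v) \subset r |: inl @: (inl @^-1: supp z))%SET.
    by apply: finset.setUS; exact: imsetS.
  apply: fintype.subset_trans sI; rewrite /r; case: leP => zp.
    by apply: theta2_supp'; rewrite bv.
  by apply: theta2_supp; rewrite bv ltW.
- apply/supp_subP => -[u|c]; rewrite !inE negb_or => /andP[xr].
    rewrite /rho' /= => xz; suff -> : z (inl u) = 0 by rewrite mulr0.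
    by apply: not_supp; apply: contra xz => uz; apply: imset_f; rewrite inE.
  move=> _; move: xr; rewrite /r; case: leP => zp; case: c => //= _.
    by rewrite /rho' eqxx mp_eq0.
  rewrite /rho' /=; have [->|z0] := S_qp zS; first by rewrite mulr0.
  by move: zp; rewrite z0; lra.
Qed.

Let slide2_wedge (x : wedge2 vw vq * R) :
  wedge2 vw vq ((set_val x.1).1, set_pt (slide2_realization x)).
Proof.
case: (set_ptP x.1) => [y1|y2]; first by left.
have seg_q : segment (theta2 (set_val (psi_pt x.1))) (rho' (set_val (set_val x.1).2)) (clip x.2)
    = unit_mass R q.
  rewrite y2 theta2_q ?rho'_q ?segmentxx //.
  by rewrite psi_pt_v //; lra.
by right; apply: set_pt_inj; exact: seg_q.
Qed.

Let slide3_realization (x : wedge2 vw vq * R) :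
  realization R S (segment (rho' (set_val (set_val x.1).2)) (set_val (set_val x.1).2) (clip x.2)).
Proof.
have [bz zS] := set_val_realization (set_val x.1).2.
apply: (segment_realization _ _ zS) => //; first exact: rho'_barycentric.
by rewrite clip_ge0 clip_le1.
Qed.

Let slide3_wedge (x : wedge2 vw vq * R) :
  wedge2 vw vq ((set_val x.1).1, set_pt (slide3_realization x)).
Proof.
case: (set_ptP x.1) => [y1|y2]; first by left.
have seg_q : segment (rho' (set_val (set_val x.1).2)) (set_val (set_val x.1).2) (clip x.2)
    = unit_mass R q.
  by rewrite y2 rho'_q segmentxx.
by right; apply: set_pt_inj; exact: seg_q.
Qed.

Let slide1 (x : wedge2 vw vq * R) : wedge2 vw vq := set_pt (slide1_wedge x).
Let slide2 (x : wedge2 vw vq * R) : wedge2 vw vq := set_pt (slide2_wedge x).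
Let slide3 (x : wedge2 vw vq * R) : wedge2 vw vq := set_pt (slide3_wedge x).

(** On A the composite is the identity. On the suspension branch [slide1] brings the first
    coordinate back to w within w*E, [slide2] deforms the second one into [rho'], and [slide3]
    undoes [rho']. *)
Let theta_psi_homotopic : homotopic_rel R a0W a0W (theta \o psi_pt) idfun.
Proof.
have cv1 : continuous (fun x : wedge2 vw vq * R => set_val (set_val x.1).1).
  exact: (comp_continuous (@fst_continuous _ _) wedge_val1_continuous).
have cv2 : continuous (fun x : wedge2 vw vq * R => set_val (set_val x.1).2).
  exact: (comp_continuous (@fst_continuous _ _) wedge_val2_continuous).
have cw1 : continuous (fun x : wedge2 vw vq * R => (set_val x.1).1).
  by apply: fst_comp_continuous; apply: val_comp_continuous; exact: fst_continuous.
have cpsi : continuous (fun x : wedge2 vw vq * R => set_val (psi_pt x.1)).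
  apply: (@val_comp_continuous _ _ _ (fun x : wedge2 vw vq * R => psi_pt x.1)).
  exact: (comp_continuous (@fst_continuous _ _) psi_continuous).
have cclip : continuous (fun x : wedge2 vw vq * R => clip x.2).
  by apply: clip_continuous; exact: snd_continuous.
have a0_psi : set_val (psi_pt a0W) = set_val a0 by rewrite psi_a0.
have theta2_a0 : theta2 (set_val a0) = unit_mass R q.
  by rewrite theta2_q // A_v; lra.
apply: (@homotopic_rel_trans R _ _ _ _ _ (fun y : wedge2 vw vq => slide1 (y, 1))).
  apply: (homotopic_rel_unit (H := slide1)).
  - apply: sub_continuous; apply: pair_continuous; apply: sub_continuous.
    + by apply: segment_continuous => //; exact: (theta1_continuous cpsi).
    + exact: (theta2_continuous cpsi).
  - move=> y; apply: set_pt_inj; congr (_, _); apply: set_pt_inj.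
    by rewrite set_ptE clip_eq0 // segment0.
  - by [].
  - move=> s; apply: set_pt_inj; congr (_, _); apply: set_pt_inj.
      by rewrite set_ptE a0_psi theta1_id ?A_v // segmentxx.
    by rewrite set_ptE a0_psi theta2_a0.
apply: (@homotopic_rel_trans R _ _ _ _ _ (fun y : wedge2 vw vq => slide2 (y, 1))).
  apply: (homotopic_rel_unit (H := slide2)).
  - apply: sub_continuous; apply: pair_continuous => //; apply: sub_continuous.
    apply: segment_continuous => //; first exact: (theta2_continuous cpsi).
    exact: (rho'_continuous cv2).
  - move=> y; apply: set_pt_inj; congr (_, _); apply: set_pt_inj.
      by rewrite set_ptE clip_eq1 // segment1.
    by rewrite set_ptE clip_eq0 // segment0.
  - by [].
  - move=> s; apply: set_pt_inj; congr (_, _); apply: set_pt_inj.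
    by rewrite set_ptE a0_psi theta2_a0 rho'_q segmentxx.
apply: (homotopic_rel_unit (H := slide3)).
- apply: sub_continuous; apply: pair_continuous => //; apply: sub_continuous.
  by apply: segment_continuous => //; exact: (rho'_continuous cv2).
- move=> y; apply: set_pt_inj; congr (_, _); apply: set_pt_inj.
  by rewrite !set_ptE clip_eq0 // clip_eq1 // segment0 segment1.
- move=> y; apply: set_pt_inj; rewrite [RHS]surjective_pairing; congr (_, _).
  by apply: set_pt_inj; rewrite set_ptE clip_eq1 // segment1.
- move=> s; apply: set_pt_inj; congr (_, _); apply: set_pt_inj.
  by rewrite set_ptE rho'_q segmentxx.
Qed.

Lemma cone_attachment_rel_equiv : pointed_equiv R a0K a0W.
Proof.
by exists theta, psi_pt; split.
Qed.

End cone_attachment.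

(* K = A u v*E, and the cone w*E lies in A, so that attaching v*E to A amounts, *)
(* up to homotopy, to attaching the suspension of E at the single point w.      *)
Lemma cone_attachment_equiv (R : realType) (V : finType) (A E K : simplicial_complex V)
    (v w : V) (wK : [set w]%SET \in K) (wA : [set w]%SET \in A)
    (qS : [set inr false]%SET \in suspension E) :
  (forall s : {set V}, (s \in K) = (s \in A) || (s :\ v \in E)) ->
  (forall s : {set V}, s \in E -> w |: s \in A) -> [set v]%SET \notin A ->
  pointed_equiv R (vertex R wK) (wedge2_base (vertex R wA) (vertex R qS)).
Proof.
move=> KE wEA vA.
have := cone_attachment_rel_equiv KE wEA vA qS wA (vertex R wA).
by congr (pointed_equiv _ _ _); apply: set_pt_inj.
Qed.

Lemma simplicial_complex_ext (V : finType) (K L : simplicial_complex V) :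
  K = L :> {set {set V}} -> K = L.
Proof.
case: K L => [K hK] [L hL] /= KL; case: _ / KL hL => hL.
by congr SimplicialComplex; exact: Prop_irrelevance.
Qed.

(** * Suspensions and iterated cones *)

Section suspension_theory.
Variables (R : realType) (V : finType) (K : simplicial_complex V).

Lemma suspension_apex c : finset.set0 \in K -> [set inr c]%SET \in suspension K.
Proof.
move=> K0; rewrite suspensionE; apply/andP; split.
  by apply: faces_sub K0; apply/fintype.subsetP => x; rewrite !inE.
by rewrite !inE; case: c.
Qed.

Lemma suspension_vertex x : [set x]%SET \in K -> [set inl x]%SET \in suspension K.
Proof.
move=> xK; rewrite suspensionE; apply/andP; split.
  by apply: faces_sub xK; apply/fintype.subsetP => y; rewrite !inE => /eqP[->].
by rewrite !inE.
Qed.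

Lemma suspension_edge c x : [set x]%SET \in K -> [set inr c; inl x]%SET \in suspension K.
Proof.
move=> xK; rewrite suspensionE; apply/andP; split.
  by apply: faces_sub xK; apply/fintype.subsetP => y; rewrite !inE => /eqP[->].
by rewrite !inE; case: c.
Qed.

(** The vertex x links the two poles; every vertex of [K] is adjacent to both. *)
Lemma suspension_joined x : [set x]%SET \in K ->
  forall a b : realization R (suspension K), joined R a b.
Proof.
move=> xK; apply: (@connected_joined _ _ _ (inr false)).
have adj c y : [set y]%SET \in K ->
    adjacent (suspension K) (inr c) (inl y) && adjacent (suspension K) (inl y) (inr c).
  by move=> yK; rewrite /adjacent /= [X in _ && (X \in _)]finset.setUC suspension_edge.
case=> [y|[]] yS.
- have yK : [set y]%SET \in K.
    have := yS; rewrite suspensionE => /andP[+ _]; apply: faces_sub.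
    by apply/fintype.subsetP => z; rewrite !inE => /eqP ->.
  by apply: connect1; have /andP[] := adj false y yK.
- apply: (@connect_trans _ _ (inl x)); apply: connect1.
    by have /andP[] := adj true x xK.
  by have /andP[] := adj false x xK.
- exact: connect0.
Qed.

End suspension_theory.

(** * Isomorphisms of complexes and their suspensions *)

Section complex_isomorphism.
Variable R : realType.

(** The maps are inverse on vertices only, as the ambient types may contain elements that are not
    vertices. *)
Definition complex_iso (V W : finType) (K : simplicial_complex V) (L : simplicial_complex W)
    (h : V -> W) (k : W -> V) :=
  [/\ simplicial_map h K L, simplicial_map k L K,
      forall x, [set x]%SET \in K -> k (h x) = x &
      forall y, [set y]%SET \in L -> h (k y) = y].

Lemma imset_face_id (V W : finType) (K : simplicial_complex V) (h : V -> W) (k : W -> V)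
    (s : {set V}) :
  (forall x, [set x]%SET \in K -> k (h x) = x) -> s \in K -> k @: (h @: s) = s.
Proof.
move=> kh sK; rewrite -imset_comp -[RHS]imset_id; apply: eq_in_imset => x xs /=.
by apply: kh; apply: faces_sub sK; rewrite finset.sub1set.
Qed.

Lemma complex_iso_equiv (V W : finType) (K : simplicial_complex V) (L : simplicial_complex W)
    (h : V -> W) (k : W -> V) x (xK : [set x]%SET \in K) (hxL : [set h x]%SET \in L) :
  complex_iso K L h k -> pointed_equiv R (vertex R xK) (vertex R hxL).
Proof.
move=> [hKL kLK kh hk]; apply: (@contiguous_equiv R V W K L h k) => //; last exact: kh.
  by move=> s sK; rewrite (imset_face_id kh sK) finset.setUid.
by move=> s sL; rewrite (imset_face_id hk sL) finset.setUid.
Qed.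

(** Connectedness of the target frees its base point, as required for the arbitrary base points of
    the final wedge. *)
Lemma complex_iso_joined_equiv (V W : finType) (K : simplicial_complex V)
    (L : simplicial_complex W) (h : V -> W) (k : W -> V) x (xK : [set x]%SET \in K) :
  complex_iso K L h k -> (forall b c : realization R L, joined R b c) ->
  forall b : realization R L, pointed_equiv R (vertex R xK) b.
Proof.
move=> hk Lj b; have hxL : [set h x]%SET \in L.
  by have [hKL _ _ _] := hk; rewrite -imset_set1; exact: hKL.
apply: (pointed_equiv_trans (complex_iso_equiv xK hxL hk)).
exact: realization_base_change.
Qed.

Definition suspension_map (V W : Type) (h : V -> W) (x : V + bool) : W + bool :=
  match x with inl y => inl (h y) | inr c => inr c end.

Lemma suspension_map_simplicial (V W : finType) (K : simplicial_complex V)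
    (L : simplicial_complex W) (h : V -> W) :
  simplicial_map h K L -> simplicial_map (suspension_map h) (suspension K) (suspension L).
Proof.
move=> hKL s; rewrite !suspensionE => /andP[sK sb]; apply/andP; split.
  apply: faces_sub (hKL _ sK); apply/fintype.subsetP => y; rewrite inE => /imsetP[[z|c] zs //= [->]].
  by apply: imset_f; rewrite inE.
have E c : (inr c \in suspension_map h @: s) = (inr c \in s).
  apply/imsetP/idP => [[[z|c'] zs //= [->//]]|cs]; by exists (inr c).
by rewrite !E.
Qed.

Lemma suspension_iso (V W : finType) (K : simplicial_complex V) (L : simplicial_complex W)
    (h : V -> W) (k : W -> V) :
  complex_iso K L h k ->
  complex_iso (suspension K) (suspension L) (suspension_map h) (suspension_map k).
Proof.
have suspK (V' : finType) (K' : simplicial_complex V') x :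
    [set inl x]%SET \in suspension K' -> [set x]%SET \in K'.
  rewrite suspensionE => /andP[+ _]; apply: faces_sub.
  by apply/fintype.subsetP => z; rewrite !inE => /eqP ->.
move=> [hKL kLK kh hk]; split.
- exact: suspension_map_simplicial.
- exact: suspension_map_simplicial.
- by case=> [x /suspK xK|//] /=; rewrite kh.
- by case=> [x /suspK xK|//] /=; rewrite hk.
Qed.

End complex_isomorphism.

Section iterated_cone_attachment.
Variables (R : realType) (V : finType) (A B C E K : simplicial_complex V) (v w u : V).
Hypothesis KE : forall s : {set V}, (s \in K) = (s \in A) || (s :\ v \in E).
Hypothesis EE : forall s : {set V}, (s \in E) = (s \in B) || (s :\ w \in C).
Hypothesis wBA : forall s : {set V}, s \in B -> w |: s \in A.
Hypothesis uCB : forall s : {set V}, s \in C -> u |: s \in B.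
Hypotheses (vA : [set v]%SET \notin A) (wB : [set w]%SET \notin B).
Hypothesis C0 : finset.set0 \in C.

(** Coning w*C off by w again adds nothing, and C lies in B because u*C does. *)
Lemma iterated_wEA (s : {set V}) : s \in E -> w |: s \in A.
Proof.
rewrite EE => /orP[/wBA//|sC].
have sB : s :\ w \in B by apply: faces_sub (uCB sC); exact: finset.subsetUr.
apply: faces_sub (wBA sB); apply/fintype.subsetP => x; rewrite !inE.
by case: (x == w).
Qed.

Let uB : [set u]%SET \in B. Proof. by have := uCB C0; rewrite finset.setU0. Qed.
Let B0 : finset.set0 \in B. Proof. by apply: faces_sub uB; exact: finset.sub0set. Qed.
Let E0 : finset.set0 \in E. Proof. by rewrite EE B0. Qed.

Lemma iterated_wA : [set w]%SET \in A.
Proof. by have := wBA B0; rewrite finset.setU0. Qed.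
Let wA := iterated_wA.

Let uE : [set u]%SET \in E. Proof. by rewrite EE uB. Qed.

(** With E = B u w*C, the suspension of E is that of B with a cone over the suspension of C attached
    from the apex [inl w]. Since u*C lies in B, cone attachment applies again inside the second
    factor. *)
Lemma iterated_cone_attachment_equiv (wK : [set w]%SET \in K) (wA' : [set w]%SET \in A)
    (uSB : [set inl u]%SET \in suspension B)
    (qSSC : [set inr false]%SET \in suspension (suspension C)) :
  pointed_equiv R (vertex R wK)
    (wedge2_base (vertex R wA') (wedge2_base (vertex R uSB) (vertex R qSSC))).
Proof.
have qSE := suspension_apex false E0.
apply: (pointed_equiv_trans (cone_attachment_equiv R wK wA' qSE KE iterated_wEA vA)).
apply: wedge2_equiv; first exact: pointed_equiv_refl.
have uSE := suspension_vertex uE.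
(* The first attachment leaves the base point at the pole q; the second one needs it at u. *)
apply: (pointed_equiv_trans (realization_base_change (suspension_joined uE _ (vertex R uSE)))).
apply: (@cone_attachment_equiv R _ _ (suspension C) _ (inl w)).
- move=> s; rewrite !suspensionE EE andb_orl; congr (_ || _ && ~~ _).
    by congr (_ \in C); apply/setP => x; rewrite !inE.
  by rewrite !inE.
- move=> s; rewrite !suspensionE => /andP[sC spq]; apply/andP; split; last by rewrite !inE.
  apply: faces_sub (uCB sC); apply/fintype.subsetP => x; rewrite !inE.
  by case/orP => [/eqP[->]|->]; rewrite ?eqxx ?orbT.
- rewrite suspensionE negb_and; apply/orP; left; apply: contra wB; apply: faces_sub.
  by apply/fintype.subsetP => x; rewrite !inE => /eqP ->.
Qed.

End iterated_cone_attachment.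

Local Open Scope nat_scope.

Section cone_union.
Variable V : finType.

Definition cone_union_faces (A E : simplicial_complex V) (v : V) : {set {set V}} :=
  [set s : {set V} | (s \in A) || (s :\ v \in E)]%SET.

Lemma cone_union_faces_sub A E v (s s' : {set V}) :
  s \subset s' -> s' \in cone_union_faces A E v -> s \in cone_union_faces A E v.
Proof.
move=> ss; rewrite !inE => /orP[s'A|s'E]; apply/orP; [left|right].
  exact: faces_sub s'A.
by apply: faces_sub s'E; exact: finset.setSD.
Qed.

Definition cone_union A E v := SimplicialComplex (@cone_union_faces_sub A E v).

Lemma cone_unionE A E v (s : {set V}) : (s \in cone_union A E v) = (s \in A) || (s :\ v \in E).
Proof. by rewrite inE. Qed.

End cone_union.

(** * Transversals of a column family *)

Section valued_complex.

(** Facets are sets of natural numbers and N only supplies the ambient type, so that one family can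
    be read in the different vertex types of the Young complexes. *)
Definition valued_faces (N : nat) (G : set (set nat)) : {set {set 'I_N}} :=
  [set s : {set 'I_N} | `[< exists2 g, G g & forall x, x \in s -> g x >]]%SET.

Lemma valued_faces_sub N G (s s' : {set 'I_N}) :
  s \subset s' -> s' \in valued_faces N G -> s \in valued_faces N G.
Proof.
move=> /fintype.subsetP ss; rewrite !finset.in_set => /asboolP H.
case: H => g Gg gs; apply/asboolP.
by exists g => // x /ss/gs.
Qed.

Definition valued_complex N G := SimplicialComplex (@valued_faces_sub N G).

Lemma valuedP N G (s : {set 'I_N}) :
  s \in valued_complex N G <-> exists2 g, G g & forall x, x \in s -> g x.
Proof. by rewrite finset.in_set; split=> [/asboolP|H]; [|apply/asboolP]. Qed.

Lemma valued_complex_eq N (G G' : set (set nat)) :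
  (forall g, G g -> exists2 g', G' g' & g `<=` g') ->
  (forall g, G' g -> exists2 g', G g' & g `<=` g') ->
  valued_complex N G = valued_complex N G'.
Proof.
move=> GG' G'G; apply: simplicial_complex_ext; apply/setP => s.
apply/idP/idP => /valuedP[g Gg gs]; apply/valuedP.
  by have [g' Gg' gg'] := GG' g Gg; exists g' => // x /gs/gg'.
by have [g' Gg' gg'] := G'G g Gg; exists g' => // x /gs/gg'.
Qed.

Lemma valued_iso N N' (G : set (set nat)) :
  (forall g x, G g -> g x -> x <= N /\ x <= N') ->
  complex_iso (valued_complex N.+1 G) (valued_complex N'.+1 G)
    (fun x => inord x) (fun x => inord x).
Proof.
move=> GN; split.
- move=> s /valuedP[g Gg gs]; apply/valuedP; exists g => // _ /imsetP[x xs ->].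
  by rewrite inordK; [exact: gs|rewrite ltnS; have [] := GN g _ Gg (gs x xs)].
- move=> s /valuedP[g Gg gs]; apply/valuedP; exists g => // _ /imsetP[x xs ->].
  by rewrite inordK; [exact: gs|rewrite ltnS; have [] := GN g _ Gg (gs x xs)].
- move=> x /valuedP[g Gg gs]; apply: val_inj.
  have [_ xN'] := GN g _ Gg (gs x (set11 x)).
  by have inx : (inord x : 'I_N'.+1) = x :> nat by [rewrite inordK]; rewrite /= inordK inx.
- move=> x /valuedP[g Gg gs]; apply: val_inj.
  have [xN _] := GN g _ Gg (gs x (set11 x)).
  by have inx : (inord x : 'I_N.+1) = x :> nat by [rewrite inordK]; rewrite /= inordK inx.
Qed.

End valued_complex.

(* D i x: x is an entry of column i of the partition without its first row. The *)
(* second row has the entries q + i.+1, the first one the entries q + t + i.+1. *)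
Section column_chains.
Variables (t n q : nat) (D : nat -> nat -> bool).
Hypotheses (t_gt0 : 0 < t) (tn : t < n).
Hypothesis D_le : forall i x, D i x -> x <= q + i.+1.
Hypothesis D_top : forall i, i < n -> D i (q + i.+1).

Definition column_chain k (a : nat -> nat) :=
  (forall i, i < k -> D i (a i)) /\ (forall i j, i < j -> j < k -> a i < a j).

Definition lower_facets m : set (set nat) :=
  [set g | exists2 a, column_chain m a & g = [set x | exists2 i, i < m & x = a i]].

(** The transversals of the first m columns of the full diagram: k columns below the first row, then
    the first row. The values m = n and m = n - t - 1 give the complexes of lambda and lambda'''. *)
Definition mixed_facets m : set (set nat) :=
  [set g | exists k a, [/\ k <= m, column_chain k a &
    g = [set x | (exists2 i, i < k & x = a i) \/
                 (exists2 i, k <= i < m & x = q + t + i.+1)]]].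

Definition extend k (a : nat -> nat) i := if i < k then a i else q + i.+1.

(** The second-row entry bounds its column below the first row, so passing to the second row at any
    column keeps the sequence increasing. *)
Lemma extend_chain k m a :
  k <= m -> m <= n -> column_chain k a -> column_chain m (extend k a).
Proof.
move=> km mn [aD a_incr]; split=> [i im|i j ij jm]; rewrite /extend.
  by case: ifP => [/aD//|_]; apply: D_top; lia.
case: (ltnP j k) => jk; first by rewrite ifT ?a_incr //; lia.
case: ifP => ik; last by lia.
by have := D_le (aD i ik); lia.
Qed.

Variable N : nat.
Hypothesis wN : q + n <= N.

Local Notation V := 'I_N.+1.
Let A := valued_complex N.+1 (lower_facets n).
Let w : V := inord (q + n).
Let wE : (w : nat) = q + n. Proof. by rewrite inordK; lia. Qed.

Lemma lowerP m (s : {set V}) : s \in valued_complex N.+1 (lower_facets m) <->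
  exists2 a, column_chain m a & forall x, x \in s -> exists2 i, i < m & (x : nat) = a i.
Proof.
split=> [/valuedP[_ [a am ->] H]|[a am H]]; first by exists a.
by apply/valuedP; exists [set x | exists2 i, i < m & x = a i] => //; exists a.
Qed.

Lemma mixedP m (s : {set V}) : s \in valued_complex N.+1 (mixed_facets m) <->
  exists k a, [/\ k <= m, column_chain k a & forall x, x \in s ->
    (exists2 i, i < k & (x : nat) = a i) \/ (exists2 i, k <= i < m & (x : nat) = q + t + i.+1)].
Proof.
split=> [/valuedP[_ [k [a [km ak ->]]] H]|[k [a [km ak H]]]]; first by exists k, a.
apply/valuedP; exists [set x | (exists2 i, i < k & x = a i) \/
                 (exists2 i, k <= i < m & x = q + t + i.+1)] => //.
by exists k, a.
Qed.

(** In a transversal the last entry can be replaced by w, so entries before the last column are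
    adjacent to w. A last entry is adjacent to the first entry of its transversal, which lies in an
    earlier column because n > 1. *)
Lemma lower_joined (R : realType) (a b : realization R A) : joined R a b.
Proof.
apply: (@connected_joined _ _ _ w) => x xA.
have [c [cD c_incr] H] := (lowerP _ _).1 xA.
have [i im xi] := H x (set11 x).
have low (y : V) j : j < n.-1 -> (y : nat) = c j -> adjacent A y w.
  move=> jn yj; apply/lowerP; exists (extend n.-1 c).
    apply: extend_chain; try lia; split=> [l ln|l m lm mn].
      by apply: cD; lia.
    by apply: c_incr => //; lia.
  move=> z; rewrite !inE => /orP[/eqP->|/eqP->].
    by exists j; [lia|rewrite /extend jn].
  by exists n.-1; [lia|rewrite wE /extend ltnn; lia].
have [in'|in'] := ltnP i n.-1; first by apply: connect1; exact: low xi.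
have c0N : c 0 < N.+1 by have := D_le (cD 0 _); lia.
apply: (@connect_trans _ _ (Ordinal c0N)); apply: connect1.
  apply/lowerP; exists c; first by split.
  move=> z; rewrite !inE => /orP[/eqP->|/eqP->]; first by exists i.
  by exists 0; [lia|].
by apply: (low _ 0) => //; lia.
Qed.

Hypothesis nN : q + t + n <= N.

Let B := valued_complex N.+1 (lower_facets n.-1).
Let C := valued_complex N.+1 (mixed_facets (n - t - 1)).
Let K := valued_complex N.+1 (mixed_facets n).
Let v : V := inord (q + t + n).
Let u : V := inord (q + n.-1).
Let vE : (v : nat) = q + t + n. Proof. by rewrite inordK; lia. Qed.
Let uE : (u : nat) = q + n.-1. Proof. by rewrite inordK; lia. Qed.

Lemma lower_wBA (s : {set V}) : s \in B -> w |: s \in A.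
Proof.
move=> /lowerP[a am H]; apply/lowerP; exists (extend n.-1 a).
  by apply: extend_chain => //; lia.
move=> x; rewrite !inE => /orP[/eqP->|/H[i im ->]].
  by exists n.-1; [lia|rewrite wE /extend ltnn; lia].
by exists i; [lia|rewrite /extend im].
Qed.

(** The first-row entry of column i is the second-row entry of column i + t. Continuing the lower
    prefix along the second row thus meets the whole tail, as i + t < n - 1, and also u, in column n
    - 2 (from 0), which lies beyond the prefix as k <= n - t - 1. *)
Lemma lower_uCB (s : {set V}) : s \in C -> u |: s \in B.
Proof.
move=> /mixedP[k [a [km ak H]]]; apply/lowerP; exists (extend k a).
  by apply: extend_chain => //; lia.
move=> x; rewrite !inE => /orP[/eqP->|/H[[i im ->]|[i im ->]]].
- by exists n.-2; [lia|rewrite uE /extend ifF; lia].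
- by exists i; [lia|rewrite /extend im].
- by exists (i + t); [lia|rewrite /extend ifF; lia].
Qed.

Lemma lower_le m (s : {set V}) x :
  s \in valued_complex N.+1 (lower_facets m) -> x \in s -> (x : nat) <= q + m.
Proof.
by move=> /lowerP[a [aD _] H] /H[i im ->]; have := D_le (aD i im); lia.
Qed.

Lemma lower_vA : [set v]%SET \notin A.
Proof. by apply/negP => /lower_le/(_ (set11 v)); rewrite vE; lia. Qed.

Lemma lower_wB : [set w]%SET \notin B.
Proof. by apply/negP => /lower_le/(_ (set11 w)); rewrite wE; lia. Qed.

Lemma mixed_set0 m : finset.set0 \in valued_complex N.+1 (mixed_facets m).
Proof.
apply/mixedP; exists 0, (fun=> 0); split=> // x; by rewrite inE.
Qed.

Let E := cone_union B C w.
Let K' := cone_union A E v.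
(** The threshold q + n is the largest entry of A. First-row entries up to it occur in the second
    row as well and are kept. *)
Let phi (x : V) : V := if q + n < x then v else x.

Let E_le (s : {set V}) x : s \in E -> x \in s -> (x : nat) <= q + n.
Proof.
rewrite cone_unionE => /orP[sB|sC] xs; first by have := lower_le sB xs; lia.
have [->|xw] := eqVneq x w; first by rewrite wE.
have xsw : x \in u |: s :\ w by rewrite !inE xs xw orbT.
by have := lower_le (lower_uCB sC) xsw; lia.
Qed.

Let phi_id (x : V) : (x : nat) <= q + n -> phi x = x.
Proof. by rewrite /phi leqNgt => /negbTE ->. Qed.

Let phi_v : phi v = v.
Proof. by rewrite /phi; case: ifP. Qed.

Let K'_phi (s : {set V}) : s \in K' -> phi @: s = s.
Proof.
move=> sK; rewrite -[RHS]imset_id; apply: eq_in_imset => x xs /=.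
have [->//|xv] := eqVneq x v; apply: phi_id.
move: sK; rewrite cone_unionE => /orP[sA|sE]; first exact: lower_le sA xs.
by apply: (E_le sE); rewrite !inE xv.
Qed.

Lemma lower_mixed (s : {set V}) : s \in A -> s \in K.
Proof.
move=> /lowerP[a am H]; apply/mixedP; exists n, a; split=> // x /H[i im xi].
by left; exists i.
Qed.

(** A transversal of the first n - 1 columns is completed by v in the last one. For faces from C,
    both w and v are met by continuing along the first row. *)
Let K'_K (s : {set V}) : s \in K' -> s \in K.
Proof.
rewrite !cone_unionE => /or3P[/lower_mixed//|/lowerP[a am H]|/mixedP[k [a [km ak H]]]]; apply/mixedP.
  exists n.-1, a; split=> // [|x xs]; first by lia.
  have [->|xv] := eqVneq x v; first by right; exists n.-1; [lia|rewrite vE; lia].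
  by have [|i im xi] := H x; [rewrite !inE xv|left; exists i].
exists k, a; split=> // [|x xs]; first by lia.
have [->|xv] := eqVneq x v; first by right; exists n.-1; [lia|rewrite vE; lia].
(* w = q + n is also the first-row entry of column n - t - 1 (from 0), the first column beyond those
   of C. *)
have [->|xw] := eqVneq x w; first by right; exists (n - t - 1); [lia|rewrite wE; lia].
have [|[i im xi]|[i im xi]] := H x; first by rewrite !inE xv xw.
  by left; exists i.
by right; exists i => //; lia.
Qed.

(** A transversal that never enters the first row is a face of A, fixed by [phi]. Otherwise its
    facet contains v, so adding the image stays in the facet. If k <= n - t - 1, the first-row
    entries other than v and w left in the image belong to columns of C. If k is larger, every
    first-row entry exceeds q + n and has become v, which leaves a face of B. *)
Let K_phi (s : {set V}) : s \in K -> phi @: s \in K' /\ s :|: phi @: s \in K.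
Proof.
move=> sK; have [k [a [kn ak H]]] := (mixedP _ _).1 sK.
have [kn'|kn'] := eqVneq k n.
  have sA : s \in A.
    apply/lowerP; exists a; rewrite -kn' // => x /H[//|[i im _]]; lia.
  have sK' : s \in K' by rewrite cone_unionE sA.
  by rewrite (K'_phi sK') finset.setUid.
have phiP x : x \in phi @: s -> x = v \/ x \in s /\ (x : nat) <= q + n.
  case/imsetP => y ys ->; case: (ltnP (q + n) y) => yn.
    by left; rewrite /phi yn.
  by right; rewrite phi_id.
split; last first.
  apply/mixedP; exists k, a; split=> // x; rewrite inE => /orP[/H//|/phiP[->|[/H]]//].
  by right; exists n.-1; [lia|rewrite vE; lia].
rewrite cone_unionE; apply/orP; right; rewrite cone_unionE; apply/orP.
have [kt|kt] := leqP k (n - t - 1).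
  right; apply/mixedP; exists k, a; split=> // x; rewrite !inE => /and3P[xw xv].
  move=> /phiP[xv'|[/H[|[i im xi]] xn]]; [by rewrite xv' eqxx in xv|by left|].
  right; exists i => //; suff : (x : nat) != q + n by lia.
  by rewrite -wE (inj_eq val_inj).
left; apply/lowerP; exists (extend k a).
  by apply: extend_chain => //; lia.
move=> x; rewrite !inE => /andP[xv] /phiP[xv'|[/H[[i im xi]|[i im xi]] xn]].
- by rewrite xv' eqxx in xv.
- by exists i; [lia|rewrite /extend im].
- by lia.
Qed.

Lemma lower_wA : [set w]%SET \in A.
Proof.
have B0 : finset.set0 \in B.
  by apply: faces_sub (lower_uCB (mixed_set0 _)); exact: finset.sub0set.
by have := lower_wBA B0; rewrite finset.setU0.
Qed.

(** [phi] and the inclusion of [K'] are inverse up to contiguity, and [K'] is an iterated cone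
    attachment by construction. *)
Lemma mixed_equiv (R : realType) (wK : [set w]%SET \in K) (wA' : [set w]%SET \in A)
    (uSB : [set inl u]%SET \in suspension B)
    (qSSC : [set inr false]%SET \in suspension (suspension C)) :
  pointed_equiv R (vertex R wK)
    (wedge2_base (vertex R wA') (wedge2_base (vertex R uSB) (vertex R qSSC))).
Proof.
have phi_w : phi w = w by apply: phi_id; rewrite wE.
have wK' : [set w]%SET \in K' by rewrite cone_unionE lower_wA.
have wphiK' : [set phi w]%SET \in K' by rewrite phi_w.
apply: (@pointed_equiv_trans R _ _ _ _ (vertex R wK')).
  have : pointed_equiv R (vertex R wK) (vertex R wphiK').
    apply: (@contiguous_equiv R _ _ _ _ phi id).
    - by move=> s /K_phi[].
    - by move=> s /K'_K; rewrite imset_id.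
    - by move=> s /K_phi[]; rewrite imset_id.
    - by move=> s sK'; rewrite imset_id (K'_phi sK') finset.setUid.
    - exact: phi_w.
  by congr (pointed_equiv _ _ _); apply: set_pt_inj; rewrite !set_ptE phi_w.
apply: (@iterated_cone_attachment_equiv R _ A B C E K' v w u).
- exact: cone_unionE.
- exact: cone_unionE.
- exact: lower_wBA.
- exact: lower_uCB.
- exact: lower_vA.
- exact: lower_wB.
- exact: mixed_set0.
Qed.

End column_chains.

Section mixed_wedge.
Variables (t n q : nat) (D : nat -> nat -> bool).
Hypotheses (t_gt0 : 0 < t) (tn : t < n).
Hypothesis D_le : forall i x, D i x -> x <= q + i.+1.
Hypothesis D_top : forall i, i < n -> D i (q + i.+1).

Lemma lower_facets_le m g x : lower_facets D m g -> g x -> x <= q + m.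
Proof. by move=> [a [aD _] ->] [i im ->]; have := D_le (aD i im); lia. Qed.

Lemma mixed_facets_le m g x : mixed_facets t q D m g -> g x -> x <= q + t + m.
Proof.
move=> [k [a [km [aD _] ->]]] [[i im ->]|[i im ->]]; last by lia.
by have := D_le (aD i im); lia.
Qed.

(** Each complex may live in its own vertex type. The bound for [N3] comes from q + t + (n - t - 1)
    = q + n.-1. *)
Lemma mixed_wedge3 (R : realType) N N1 N2 N3 :
  q + t + n <= N -> q + n <= N1 -> q + n.-1 <= N2 -> q + n.-1 <= N3 ->
  forall (x1 : realization R (valued_complex N1.+1 (lower_facets D n)))
         (x2 : realization R (suspension (valued_complex N2.+1 (lower_facets D n.-1))))
         (x3 : realization R (suspension (suspension
                 (valued_complex N3.+1 (mixed_facets t q D (n - t - 1)))))),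
  homotopy_equivalent R (realization R (valued_complex N.+1 (mixed_facets t q D n)))
    (wedge3 x1 x2 x3).
Proof.
move=> hN hN1 hN2 hN3 x1 x2 x3.
have hw : q + n <= N by lia.
have wA := lower_wA t_gt0 tn D_le D_top hw hN.
have wK := lower_mixed t q wA.
have uB := lower_uCB t_gt0 tn D_le D_top hw hN (mixed_set0 _ _ _ _ _).
rewrite finset.setU0 in uB.
have uSB := suspension_vertex uB.
have C0 := mixed_set0 t q D N (n - t - 1).
have qSC c := suspension_apex c C0.
have qSSC : [set inr false]%SET \in
    suspension (suspension (valued_complex N.+1 (mixed_facets t q D (n - t - 1)))).
  by apply: suspension_apex; apply: faces_sub (qSC false); exact: finset.sub0set.
have [p Hp] := wedge3_equiv R (@realization_closed1 _ _ _ x1) (@realization_closed1 _ _ _ x2)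
  (@realization_closed1 _ _ _ x3).
apply: (pointed_equiv_homotopy_equivalent (x0 := vertex R wK) (y0 := p)).
apply: (pointed_equiv_trans (mixed_equiv t_gt0 tn D_le D_top hw hN R wK wA uSB qSSC)).
apply: pointed_equiv_trans Hp; apply: wedge2_equiv; last apply: wedge2_equiv.
- have iso : complex_iso (valued_complex N.+1 (lower_facets D n))
      (valued_complex N1.+1 (lower_facets D n)) inord inord.
    by apply: valued_iso => g x Gg /(lower_facets_le Gg); lia.
  exact: (complex_iso_joined_equiv wA iso (lower_joined t_gt0 tn D_le D_top hN1 (R := R))).
- have uB2 : [set inord (q + n.-1)]%SET \in valued_complex N2.+1 (lower_facets D n.-1).
    have /valuedP[g Gg gu] := uB; apply/valuedP; exists g => // x; rewrite inE => /eqP->.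
    by have := gu _ (set11 _); rewrite !inordK //; lia.
  have iso : complex_iso (valued_complex N.+1 (lower_facets D n.-1))
      (valued_complex N2.+1 (lower_facets D n.-1)) inord inord.
    by apply: valued_iso => g x Gg /(lower_facets_le Gg); lia.
  exact: (complex_iso_joined_equiv uSB (suspension_iso iso) (suspension_joined uB2)).
(* A pole of the inner suspension is the vertex that makes the outer one connected; this includes n
   = t + 1, where the complex itself has no vertices. *)
- have qSC3 := suspension_apex false (mixed_set0 t q D N3 (n - t - 1)).
  have iso : complex_iso (valued_complex N.+1 (mixed_facets t q D (n - t - 1)))
      (valued_complex N3.+1 (mixed_facets t q D (n - t - 1))) inord inord.
    by apply: valued_iso => g x Gg /(mixed_facets_le Gg); lia.
  exact: (complex_iso_joined_equiv qSSC (suspension_iso (suspension_iso iso))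
    (suspension_joined qSC3)).
Qed.

End mixed_wedge.

(** * Young complexes *)

Section young_entries.
Variable t : nat.
Implicit Type mu : seq nat.

Lemma in_columnP mu i x :
  reflect (exists2 j, j < size mu & i < nth 0 mu j /\ x = young_entry t mu j i)
    (in_column t mu i x).
Proof.
apply: (iffP existsP) => [[j /andP[ij /eqP->]]|[j jmu [ij ->]]]; first by exists j.
by exists (Ordinal jmu); rewrite ij eqxx.
Qed.

(** Truncation keeps the number of rows, even when parts become 0, and the entry of a box depends
    only on its column and the number of rows below it. Hence exactly the columns from m on
    disappear. *)
Lemma in_column_min m mu i x :
  in_column t [seq minn m y | y <- mu] i x = (i < m) && in_column t mu i x.
Proof.
apply/in_columnP/andP => [[j]|[im /in_columnP[j jmu [ij ->]]]].
  rewrite size_map => jmu [+ ->]; rewrite (nth_map 0) // leq_min => /andP[im ij].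
  by split=> //; apply/in_columnP; exists j; rewrite // /young_entry size_map.
exists j; first by rewrite size_map.
by rewrite (nth_map 0) // leq_min im ij /young_entry size_map.
Qed.

(** Rows are weighted by their height above the bottom one, so a new first row leaves the old
    entries unchanged. *)
Lemma in_column_cons m mu i x :
  in_column t (m :: mu) i x = (i < m) && (x == size mu * t + i.+1) || in_column t mu i x.
Proof.
apply/in_columnP/orP => [[[|j] jmu [/= ij ->]]|[/andP[im /eqP->]|/in_columnP[j jmu [ij ->]]]].
- by left; rewrite ij /young_entry /= subSS subn0 eqxx.
- by right; apply/in_columnP; exists j => //; rewrite /young_entry /= subSS.
- by exists 0 => //; rewrite /young_entry /= subSS subn0.
- by exists j.+1 => //; rewrite /young_entry /= subSS.
Qed.

Lemma in_column_bound mu i x :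
  in_column t mu i x -> i < nth 0 mu 0 -> x < young_bound t mu.
Proof.
move=> /in_columnP[j jmu [_ ->]] imu; rewrite /young_entry /young_bound ltnS.
by apply: leq_add => //; rewrite leq_mul2r; apply/orP; right; lia.
Qed.

Lemma young_complexE mu : young_complex t mu =
  valued_complex (young_bound t mu) (lower_facets (in_column t mu) (nth 0 mu 0)).
Proof.
apply: simplicial_complex_ext; apply/setP => s; rewrite inE.
apply/idP/idP => [/exists_inP[_ /imsetP[a + ->]]|/valuedP[_ [a [aD a_incr] ->] H]].
  rewrite inE => /andP[/forallP aD /forallP a_incr] /fintype.subsetP sa.
  (* The default 0 is taken only past the last column, outside the range of [column_chain]. *)
  pose b i := oapp (fun j : 'I_(nth 0 mu 0) => nat_of_ord (a j)) 0 (insub i).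
  have bE i (im : i < nth 0 mu 0) : b i = a (Ordinal im) by rewrite /b insubT.
  apply/valuedP; exists [set x | exists2 i, i < nth 0 mu 0 & x = b i].
    exists b => //; split=> [i im|i j ij jm]; first by rewrite bE; exact: (aD (Ordinal im)).
    have im := ltn_trans ij jm; rewrite !bE.
    by have /forallP/(_ (Ordinal jm)) := a_incr (Ordinal im); rewrite ij.
  move=> x /sa /imsetP[i _ ->]; exists i => //.
  by rewrite bE; congr (nat_of_ord (a _)); apply: val_inj.
pose b : {ffun 'I_(nth 0 mu 0) -> 'I_(young_bound t mu)} := [ffun i => inord (a (nat_of_ord i))].
have bE (i : 'I_(nth 0 mu 0)) : b i = a i :> nat.
  by rewrite ffunE inordK //; exact: in_column_bound (aD _ (ltn_ord i)) _.
apply/exists_inP; exists [set b i | i : 'I_(nth 0 mu 0)]%SET.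
  apply/imsetP; exists b => //; rewrite inE; apply/andP; split.
    by apply/forallP => i; rewrite bE; exact: aD.
  by apply/forallP => i; apply/forallP => j; apply/implyP => ij; rewrite !bE; exact: a_incr.
apply/fintype.subsetP => x /H[i im xi]; apply/imsetP; exists (Ordinal im) => //.
by apply: val_inj; rewrite /= bE.
Qed.

End young_entries.

Lemma lower_facets_eq N (D D' : nat -> nat -> bool) m :
  (forall i x, i < m -> D i x = D' i x) ->
  valued_complex N (lower_facets D m) = valued_complex N (lower_facets D' m).
Proof.
move=> DD'; apply: valued_complex_eq => g [a [aD a_incr] ->].
  exists [set x | exists2 i, i < m & x = a i] => //.
  by exists a => //; split=> // i im; rewrite -DD' ?aD.
exists [set x | exists2 i, i < m & x = a i] => //.
by exists a => //; split=> // i im; rewrite DD' ?aD.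
Qed.

(** * Transversals entering the first row *)

Section first_row.
Variables (t q : nat) (D D' : nat -> nat -> bool) (m : nat).
Hypothesis t_gt0 : 0 < t.
Hypothesis D_le : forall i x, D i x -> x <= q + i.+1.
Hypothesis DD' : forall i x, i < m -> D' i x = (x == q + t + i.+1) || D i x.

(** After a first-row entry q + t + i.+1, a lower entry of the next column would be at most q +
    i.+2, which is no larger as t >= 1; an increasing sequence therefore stays in the first row. *)
Lemma column_chain_mixed a : column_chain D' m a ->
  exists2 k, k <= m & column_chain D k a /\ forall i, k <= i < m -> a i = q + t + i.+1.
Proof.
move=> [aD a_incr].
(* k is the first column whose entry is not a lower one, or m. Entries common to the first row and
   to lower rows count as lower. *)
have [k [km kD kN]] : exists k, [/\ k <= m, forall i, i < k -> D i (a i) &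
    k < m -> ~~ D k (a k)].
  elim: m => [|l [k [kl kD kN]]]; first by exists 0.
  have [kl'|kl'] := eqVneq k l; last first.
    by exists k; split=> // [|_]; [lia|apply: kN; lia].
  case Dl: (D l (a l)).
    by exists l.+1; split=> // [i|]; [rewrite ltnS leq_eqVlt => /orP[/eqP->//|il]; apply: kD; lia|lia].
  by exists k; rewrite kl' Dl; split=> // i il; apply: kD; rewrite kl'.
exists k => //; split; first by split=> // i j ij jk; apply: a_incr => //; lia.
suff H d : k + d < m -> a (k + d) = q + t + (k + d).+1.
  by move=> i /andP[ki im]; have := H (i - k); rewrite subnKC //; exact.
elim: d => [|d IH] kdm.
  rewrite addn0 in kdm *; have := aD _ kdm; rewrite DD' // => /orP[/eqP//|Dk].
  by have := kN kdm; rewrite Dk.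
have := aD _ kdm; rewrite DD' // => /orP[/eqP//|Dk].
have := D_le Dk; have := a_incr (k + d) (k + d.+1) _ kdm; rewrite IH; lia.
Qed.

Lemma valued_first_row N :
  valued_complex N (lower_facets D' m) = valued_complex N (mixed_facets t q D m).
Proof.
apply: valued_complex_eq => g.
  move=> [a am ->]; have [k km [ak aT]] := column_chain_mixed am.
  exists [set x | (exists2 i, i < k & x = a i) \/ (exists2 i, k <= i < m & x = q + t + i.+1)].
    by exists k, a.
  move=> x [i im ->]; case: (ltnP i k) => ik; first by left; exists i.
  by right; exists i; [lia|apply: aT; lia].
move=> [k [a [km [aD a_incr] ->]]].
pose b i := if i < k then a i else q + t + i.+1.
exists [set x | exists2 i, i < m & x = b i].
  exists b => //; rewrite /b; split=> [i im|i j ij jm].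
    by rewrite DD' //; case: ifP => [/aD->|_]; rewrite ?orbT ?eqxx.
  case: (ltnP j k) => jk; first by rewrite ifT ?a_incr //; lia.
  by case: ifP => ik; [have := D_le (aD i ik)|]; lia.
move=> x [[i ik ->]|[i im ->]]; first by exists i; [lia|rewrite /b ik].
by exists i; [lia|rewrite /b ifF //; lia].
Qed.

End first_row.

Theorem lemma2p4 (R : realType) (t : nat) (la : seq nat) :
  0 < t ->
  is_partition la ->
  1 < size la ->
  nth 0 la 0 = nth 0 la 1 ->
  t < nth 0 la 0 ->
  let la1 := behead la in
  let la2 := [seq minn (nth 0 la 0 - 1) m | m <- behead la] in
  let la3 := [seq minn (nth 0 la 0 - t - 1) m | m <- la] in
  forall (x1 : realization R (young_complex t la1))
         (x2 : realization R (suspension (young_complex t la2)))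
         (x3 : realization R (suspension (suspension (young_complex t la3)))),
  homotopy_equivalent R (realization R (young_complex t la)) (wedge3 x1 x2 x3).
Proof.
case: la => [|n [|n' l]] // t_gt0 la_part _ nn' tn la1 la2 la3.
have {}nn' : n' = n by []; subst n'; rewrite /= in tn.
(* The columns of lambda'. As its first part is again n, every column i < n contains q + i.+1, which
   is [D_top]. *)
pose D := in_column t (n :: l); pose q := size l * t.
have D_le i x : D i x -> x <= q + i.+1.
  move=> /in_columnP[j jl [_ ->]]; rewrite /young_entry /= leq_add2r leq_mul2r.
  by apply/orP; right; lia.
have D_top i : i < n -> D i (q + i.+1) by move=> im; rewrite /D in_column_cons im eqxx.
have top i x : i < n -> in_column t [:: n, n & l] i x = (x == q + t + i.+1) || D i x.
  by move=> im; rewrite in_column_cons im /= mulSn (addnC t).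
have E0 : young_complex t [:: n, n & l] =
    valued_complex (young_bound t [:: n, n & l]) (mixed_facets t q D n).
  by rewrite young_complexE; apply: valued_first_row.
have E1 : young_complex t la1 = valued_complex (young_bound t la1) (lower_facets D n).
  exact: young_complexE.
have E2 : young_complex t la2 = valued_complex (young_bound t la2) (lower_facets D n.-1).
  rewrite young_complexE (_ : nth 0 la2 0 = n.-1); last by rewrite /la2 /=; lia.
  by apply: lower_facets_eq => i x im; rewrite in_column_min /= (_ : i < n - 1) //; lia.
(* lambda''' keeps all the rows, hence the first row is again split off, now over n - t - 1 columns
   only. *)
have E3 : young_complex t la3 =
    valued_complex (young_bound t la3) (mixed_facets t q D (n - t - 1)).
  rewrite young_complexE (_ : nth 0 la3 0 = n - t - 1); last by rewrite /la3 /=; lia.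
  by apply: valued_first_row => // i x im; rewrite in_column_min im top //; lia.
rewrite E0 E1 E2 E3.
by apply: (mixed_wedge3 t_gt0 tn D_le D_top); rewrite /q /= ?size_map ?mulSn; lia.
Qed.
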